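(* For any $r\in\mathbb R$, the operators $$\hat S^+(r)=\cosh(2r)\,\hat a_1^\dagger\hat a_2-\tfrac12\sinh(2r)\bigl((\hat a_1^\dagger)^2+\hat a_2^2\bigr),$$ $$\hat S^-(r)=\cosh(2r)\,\hat a_2^\dagger\hat a_1-\tfrac12\sinh(2r)\bigl(\hat a_1^2+(\hat a_2^\dagger)^2\bigr),\qquad \hat S^z=\frac{\hat n_1-\hat n_2}{2}$$ define an exact realization of the $\mathfrak{su}(2)$ algebra, i.e. $[\hat S^z,\hat S^\pm(r)]=\pm\hat S^\pm(r)$ and $[\hat S^+(r),\hat S^-(r)]=2\hat S^z$. At $r=0$ it reduces to the standard Jordan--Schwinger transformation $\hat S^+=\hat a_1^\dagger\hat a_2$, $\hat S^-=\hat a_2^\dagger\hat a_1$. With the two-mode squeezing operator $$\hat U(r)=\exp\bigl[r(\hat a_1^\dagger\hat a_2^\dagger-\hat a_1\hat a_2)\bigr],$$ the generators can be written as $\hat S^\pm(r)=\hat U(r)\,\hat S^\pm\,\hat U(r)^{-1}$, where $\hat S^\pm$ are the Jordan--Schwinger operators above. For $r\neq0$ the operators $\hat S^\pm(r)$ contain the terms $(\hat a_1^\dagger)^2,\hat a_2^2,\hat a_1^2,(\hat a_2^\dagger)^2$, which change the total boson number $\hat N=\hat n_1+\hat n_2$ by $\pm2$, and therefore violate the condition $[\hat N,\hat S^\pm(r)]=0$. Nevertheless, the operator $\hat N_r\equiv\hat U(r)\,\hat N\,\hat U(r)^{-1}$ commutes with all generators, $$[\hat N_r,\hat S^\pm(r)]=0,\qquad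 [\hat N_r,\hat S^z]=0,$$ and its explicit form is $$\hat N_r=\cosh(2r)\,(\hat n_1+\hat n_2)-\sinh(2r)\,(\hat a_1^\dagger\hat a_2^\dagger+\hat a_1\hat a_2)+2\sinh^2 r.$$ Consequently, the irreducible spin blocks are mapped onto the squeezed subspaces $\mathcal H_{2S}^{(r)}=\hat U(r)\,\mathcal H_{2S}$, where $\mathcal H_{2S}$ is the standard physical sector $\hat N=2S$ of the Jordan--Schwinger transformation (the case $r=0$); in the family above the irreducible spin blocks are defined by the condition $\hat N_r=2S$.
   Context: Here $\hat a_1,\hat a_2$ are the annihilation operators of two independent bosonic modes, with $[\hat a_1,\hat a_1^\dagger]=[\hat a_2,\hat a_2^\dagger]=1$ and all other commutators vanishing, acting on the two-mode bosonic Fock space with number basis $|n_1,n_2\rangle$, $(n_1,n_2)\in\mathbb N_0^2$; $\hat n_i=\hat a_i^\dagger\hat a_i$. The spin is $S\in\{\tfrac12,1,\dots\}$, and the sector $\mathcal H_{2S}$ has the basis $|2S-n,n\rangle$, $n=0,1,\dots,2S$, so its dimension is $2S+1$. By $\mathfrak{su}(2)$ algebra is meant the ladder-operator relations $[\hat S^z,\hat S^\pm]=\pm\hat S^\pm$, $[\hat S^+,\hat S^-]=2\hat S^z$. Operator identities are algebraic (formal) identities in the bosonic operators; no operator domains are specified. *)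

(* Defs.v *)
(* MathComp / MathComp-Analysis, over an arbitrary [R : realType]. *)
From HB Require Import structures.
From mathcomp Require Import all_boot all_order all_algebra.
From mathcomp Require Import all_classical all_reals all_analysis.
From mathcomp Require Export complex.
Import Order.TTheory GRing.Theory Num.Theory.
Import numFieldNormedType.Exports.

Set Implicit Arguments.
Unset Strict Implicit.
Unset Printing Implicit Defensive.

Local Open Scope classical_set_scope.
Local Open Scope ring_scope.
Local Open Scope complex_scope.

Section Hyperbolic.
Variable R : realType.
Definition cosh (x : R) : R := (expR x + expR (- x)) / 2.
Definition sinh (x : R) : R := (expR x - expR (- x)) / 2.
End Hyperbolic.

(* A vector is its family of coefficients in the number basis: the value of psi
   at (n1, n2) is the coefficient of |n1, n2>.  The Hilbert space is the set
   [ell2] below.  The ladder operators and their polynomials act on all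
   coefficient families, because each coefficient of the result depends on
   finitely many coefficients of the argument; hence an equation between such
   operators holds in particular on every domain of the Hilbert space. *)
Notation fock R := ((nat * nat)%type -> R[i]^o).
Notation op R := (fock R -> fock R).

Section Fock.
Variable R : realType.
Implicit Types (psi : fock R) (A B : op R) (V W : set (fock R)).

Definition ket (n1 n2 : nat) : fock R :=
  fun n => if n == (n1, n2) then 1 else 0.

Definition norm2 psi : \bar R :=
  \esum_(n in [set: nat * nat]) (complex.Re (psi n) ^+ 2 + complex.Im (psi n) ^+ 2)%:E.

Definition ell2 : set (fock R) := [set psi | (norm2 psi < +oo)%E].

(* a |n> = sqrt n |n - 1> and a^dagger |n> = sqrt (n + 1) |n + 1>, read on
   coefficients; at n = 0 the factor sqrt 0 kills the creation term. *)
Definition a1 psi : fock R :=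
  fun n => (Num.sqrt n.1.+1%:R)%:C * psi (n.1.+1, n.2).
Definition a2 psi : fock R :=
  fun n => (Num.sqrt n.2.+1%:R)%:C * psi (n.1, n.2.+1).
Definition a1d psi : fock R :=
  fun n => (Num.sqrt n.1%:R)%:C * psi (n.1.-1, n.2).
Definition a2d psi : fock R :=
  fun n => (Num.sqrt n.2%:R)%:C * psi (n.1, n.2.-1).

Definition commutator A B : op R := (A \o B) - (B \o A).

Definition num1 : op R := a1d \o a1.
Definition num2 : op R := a2d \o a2.
Definition numop : op R := num1 + num2.

Definition JSplus : op R := a1d \o a2.
Definition JSminus : op R := a2d \o a1.

Definition Splus (r : R) : op R :=
  (cosh (2 * r))%:C *: JSplus
  - (sinh (2 * r) / 2)%:C *: ((a1d \o a1d) + (a2 \o a2)).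
Definition Sminus (r : R) : op R :=
  (cosh (2 * r))%:C *: JSminus
  - (sinh (2 * r) / 2)%:C *: ((a1 \o a1) + (a2d \o a2d)).
Definition Sz : op R := 2^-1 *: (num1 - num2).

Definition changes_number_by (k : int) A : Prop :=
  forall (lam : R[i]) psi, numop psi = lam *: psi ->
    numop (A psi) = (lam + k%:~R) *: A psi.

(* The vectors in the domain of every power of the number operator; a dense
   domain containing the number states and stable under the ladder operators. *)
Definition smooth : set (fock R) :=
  [set psi | forall k : nat, ell2 (iter k numop psi)].

(* U r = exp (r G) for a skew-symmetric operator G defined on the number
   states: U is a one-parameter group of unitary operators of the Hilbert space
   whose strong derivative at 0 on each number state is given by G.  (Unitarity
   of U r is isometry plus invertibility, the inverse being U (- r); strong
   continuity follows from differentiability on the number states, whose span is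
   dense.)  Such a U is unique on [ell2] as soon as G is essentially
   skew-adjoint on the span of the number states.  The values of U outside
   [ell2] are irrelevant. *)
Definition unitary_group_generated_by (G : op R) (U : R -> op R) : Prop :=
  [/\ forall r (c : R[i]) psi phi, ell2 psi -> ell2 phi ->
        U r (c *: psi + phi) = c *: U r psi + U r phi,
      forall psi, ell2 psi -> U 0 psi = psi,
      forall r s psi, ell2 psi -> U (r + s) psi = U r (U s psi),
      forall r psi, ell2 psi -> norm2 (U r psi) = norm2 psi &
      forall n1 n2 : nat,
        norm2 ((h^-1)%:C *: (U h (ket n1 n2) - ket n1 n2) - G (ket n1 n2))
          @[h --> (0 : R)^'] --> (0 : \bar R)%E].

Definition squeezing_generator : op R := (a1d \o a2d) - (a1 \o a2).

(* U r A (U r)^-1 *)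
Definition conj_by (U : R -> op R) (r : R) A : op R := U r \o A \o U (- r).

Definition eq_on_smooth A B : Prop := forall psi, smooth psi -> A psi = B psi.

(* Spin sectors are indexed by the positive integer m = 2S. *)
Definition sector (m : nat) : set (fock R) :=
  [set psi | exists c : 'I_m.+1 -> R[i],
     psi = \sum_(n < m.+1) c n *: ket (m - n) n].

Definition squeezed_sector (U : R -> op R) (r : R) (m : nat) : set (fock R) :=
  U r @` sector m.

Definition subspace W : Prop :=
  W 0 /\ forall (c : R[i]) psi phi, W psi -> W phi -> W (c *: psi + phi).

Definition has_dim V (d : nat) : Prop :=
  exists e : 'I_d -> fock R,
    (forall c : 'I_d -> R[i], \sum_i c i *: e i = 0 -> forall i, c i = 0) /\
    V = [set psi | exists c : 'I_d -> R[i], psi = \sum_i c i *: e i].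

Definition stable A W : Prop := forall psi, W psi -> W (A psi).

Definition spin_stable (Sp Sm S0 : op R) W : Prop :=
  [/\ stable Sp W, stable Sm W & stable S0 W].

(* An irreducible invariant subspace of dimension m + 1 = 2S + 1. *)
Definition irreducible_spin_block (Sp Sm S0 : op R) (m : nat) V : Prop :=
  [/\ has_dim V m.+1, spin_stable Sp Sm S0 V &
      forall W, subspace W -> W `<=` V -> spin_stable Sp Sm S0 W ->
        W = [set 0] \/ W = V].

End Fock.

Arguments ell2 {R}.
Arguments numop {R}.
Arguments num1 {R}.
Arguments num2 {R}.
Arguments JSplus {R}.
Arguments JSminus {R}.
Arguments Sz {R}.
Arguments smooth {R}.
Arguments squeezing_generator {R}.
Arguments sector {R}.

(* Main.v *)
From HB Require Import structures.
Require Import Defs.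
From mathcomp Require Import all_boot all_order all_algebra.
From mathcomp Require Import all_classical all_reals all_analysis.
From mathcomp Require Import zify ring lra.
Import Order.TTheory GRing.Theory Num.Theory.
Import numFieldNormedType.Exports.

Set Implicit Arguments.
Unset Strict Implicit.
Unset Printing Implicit Defensive.

Local Open Scope classical_set_scope.
Local Open Scope ring_scope.
Local Open Scope complex_scope.

(* The Bogoliubov operators A1 r = cosh r a1 - sinh r a2^dagger and
   A2 r = cosh r a2 - sinh r a1^dagger satisfy the canonical commutation
   relations on coefficient families, and annihilate the vector sqvac r with
   coefficients tanh(r)^k / cosh(r) on |k, k>, which is unique up to a scalar.
   Applying their adjoints to sqvac r gives vectors sqket r n, and U(s) is the
   real matrix whose rows are the sqket (- s) m.  On rapidly decreasing vectors
   U(s) carries A1 r to A1 (r + s), hence U(s) (sqket r n) = sqket (r + s) n; this one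
   identity contains the orthonormality of the sqket r n, the symmetry
   U(s)^T = U(- s) and, through Bessel's inequality, the unitary group law.
   The coefficients of sqket r n solve x' = G x; expanding the square, this
   gives the strong derivative at 0.  Conversely, if U and W are two groups with generator
   G, then the numbers z_n(s) = <phi, U(s) n> - <phi, W(s) n> are bounded and
   solve z' = - G z with z(0) = 0; the Taylor estimates of this system converge
   on an interval independent of n, so that z = 0.  All remaining claims follow
   by moving U(r) across words in the ladder operators. *)

(** * Square-summable families *)

(** The generator is unbounded, so its exponential is not given by a power series of operators, and
    the hypothesis on [U] offers a derivative only at 0 and only on number states. Hence one group
    is built as an explicit matrix, and its properties reach an arbitrary [U] by uniqueness, which
    plays the part of essential skew-adjointness. The matrix is real: the analysis is done on real
    families and carried over through real and imaginary parts. The Bogoliubov relations are formal,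
    but moving an operator across an inner product leaves a boundary term in the box sums. Rapid
    decrease makes it vanish, is preserved by the ladder operators, and amounts to [smooth].
    Uniqueness is tested weakly. The generator sends a number state to two number states, so the
    pairings of a fixed [phi] with the states [U t n] form a closed system. Its matrix grows only
    linearly in the indices, so k steps produce k! times an exponential, and Taylor's formula
    cancels the k!. *)

Notation rfock R := ((nat * nat)%type -> R^o).

(** The sign of [a] is left free because for [a < 0] a large [t] violates the hypothesis. Both
    Cauchy-Schwarz inequalities, real and complex, come from here. *)
Lemma discriminant_le0 (R : realFieldType) (a b c : R) :
  (forall t, 0 <= a * t ^+ 2 + 2 * b * t + c) -> b ^+ 2 <= a * c.
Proof.
move=> h; have [a0|a0|a0] := ltgtP a 0.
- have c0 : 0 <= c by have := h 0; rewrite expr0n /= !mulr0 !add0r.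
  (* With [q] the quotient, [a * q] cancels [c + 2 |b|], so the quadratic is at most [a] at
     [1 + q]. *)
  have := h (1 + (c + 2 * `|b|) / - a).
  set q := (_ / - a); have q0 : 0 <= q.
    by apply: divr_ge0; [rewrite addr_ge0 ?mulr_ge0|rewrite oppr_ge0 ltW].
  have aq : a * q = - (c + 2 * `|b|) by rewrite /q; field; rewrite lt_eqF.
  have bb : b <= `|b| by apply: ler_norm.
  have -> : a * (1 + q) ^+ 2 + 2 * b * (1 + q) + c =
     a + a * q + (1 + q) * (a * q) + 2 * b * (1 + q) + c by ring.
  rewrite aq; nra.
- have := h (- b / a); have -> : a * (- b / a) ^+ 2 + 2 * b * (- b / a) + c =
     (a * c - b ^+ 2) / a by field; rewrite gt_eqF.
  by rewrite pmulr_lge0 ?invr_gt0// subr_ge0.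
- rewrite a0 mul0r; have [->|b0] := eqVneq b 0; first by rewrite expr0n.
  (* The linear function takes the value -1 here. *)
  have := h (- (c + 1) / (2 * b)); rewrite a0 mul0r add0r.
  by rewrite mulrCA divff ?mulf_neq0 // mulr1; lra.
Qed.

Section BoxSums.
Variable R : realType.
Implicit Types (f g : nat * nat -> R) (N : nat).

(** Square boxes form an increasing sequence of finite sets, so sums over pairs become limits of
    ordinary sequences. *)
Definition bsum f N : R := \sum_(n : 'I_N * 'I_N) f (val n.1, val n.2).

Lemma bsumE f N : bsum f N = \sum_(i < N) \sum_(j < N) f (val i, val j).
Proof. by rewrite pair_bigA. Qed.

Lemma eq_bsum f g N : f =1 g -> bsum f N = bsum g N.
Proof. by move=> fg; apply: eq_bigr. Qed.

Lemma bsumD f g N : bsum (fun n => f n + g n) N = bsum f N + bsum g N.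
Proof. exact: big_split. Qed.

Lemma bsumZ a f N : bsum (fun n => a * f n) N = a * bsum f N.
Proof. by rewrite /bsum mulr_sumr. Qed.

Lemma ler_bsum f g N : (forall n, f n <= g n) -> bsum f N <= bsum g N.
Proof. by move=> fg; apply: ler_sum. Qed.

Lemma bsum_ge0 f N : (forall n, 0 <= f n) -> 0 <= bsum f N.
Proof. by move=> f0; apply: sumr_ge0. Qed.

Lemma bsumS f N : bsum f N.+1 =
  bsum f N + (\sum_(i < N) f (val i, N) + \sum_(j < N.+1) f (N, val j)).
Proof.
rewrite !bsumE big_ord_recr /= addrA; congr (_ + _).
by rewrite -big_split; apply: eq_bigr => i _; rewrite big_ord_recr.
Qed.

Lemma nondecreasing_bsum f : (forall n, 0 <= f n) -> nondecreasing_seq (bsum f).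
Proof.
move=> f0; apply/nondecreasing_seqP => N; rewrite bsumS lerDl.
by rewrite addr_ge0 // sumr_ge0.
Qed.

Lemma bsum_stationary f N M :
    (forall n, f n != 0 -> ((n.1 < N) && (n.2 < N))%N) -> (N <= M)%N ->
  bsum f M = bsum f N.
Proof.
move=> fN; elim: M => [|M IH]; first by rewrite leqn0 => /eqP->.
rewrite leq_eqVlt => /predU1P[->//|]; rewrite ltnS => NM.
have f0 n : ((N <= n.1) || (N <= n.2))%N -> f n = 0.
  by move=> h; apply: contraTeq h => /fN; rewrite negb_or -!ltnNge.
rewrite bsumS !big1 ?addr0 ?IH // => i _; apply: f0; rewrite /= NM ?orbT//.
Qed.

Lemma le_bsum_term f N n : (forall n, 0 <= f n) -> (n.1 < N)%N -> (n.2 < N)%N ->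
  f n <= bsum f N.
Proof.
move=> f0 n1 n2; rewrite /bsum (bigD1 (Ordinal n1, Ordinal n2)) //=.
by rewrite -surjective_pairing lerDl sumr_ge0.
Qed.

Lemma bsumM (u v : nat -> R) N :
  bsum (fun n => u n.1 * v n.2) N = (\sum_(i < N) u i) * (\sum_(j < N) v j).
Proof.
rewrite bsumE mulr_suml; apply: eq_bigr => i _; by rewrite mulr_sumr.
Qed.

End BoxSums.

(** * The real Hilbert space and Bessel's inequality *)

Section RealHilbert.
Variable R : realType.
Implicit Types x y z : rfock R.

Definition l2 x := exists C : R, forall N, bsum (fun n => x n ^+ 2) N <= C.

(** [lim] returns a default value on a divergent sequence, hence the [l2] hypotheses of the
    bilinearity rules. *)
Definition ip x y : R := lim (bsum (fun n => x n * y n) @ \oo).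

Definition sq x : R := ip x x.

Definition rket (m : nat * nat) : rfock R := fun n => (n == m)%:R.

Definition trunc N x : rfock R :=
  fun n => if ((n.1 < N) && (n.2 < N))%N then x n else 0.

Lemma l20 : l2 0.
Proof. by exists 0 => N; rewrite /bsum big1 // => n _; rewrite expr0n. Qed.

Lemma l2Z a x : l2 x -> l2 (a *: x).
Proof.
move=> [C xC]; exists (a ^+ 2 * C) => N.
rewrite (eq_bsum (g := fun n => a ^+ 2 * x n ^+ 2)); last first.
  by move=> n; rewrite -exprMn.
by rewrite bsumZ ler_wpM2l // sqr_ge0.
Qed.

Lemma l2D x y : l2 x -> l2 y -> l2 (x + y).
Proof.
move=> [C xC] [D yD]; exists (2 * C + 2 * D) => N.
apply: (@le_trans _ _ (bsum (fun n => 2 * x n ^+ 2 + 2 * y n ^+ 2) N)).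
  apply: ler_bsum => n; rewrite fctE; have := sqr_ge0 (x n - y n); lra.
by rewrite bsumD !bsumZ lerD // ler_pM2l.
Qed.

Lemma l2N x : l2 x -> l2 (- x).
Proof. by move=> ?; rewrite -scaleN1r; apply: l2Z. Qed.

Lemma l2B x y : l2 x -> l2 y -> l2 (x - y).
Proof. by move=> ? ?; apply/l2D/l2N. Qed.

Lemma l2_sum J (r : seq J) (P : pred J) (F : J -> rfock R) :
  (forall i, P i -> l2 (F i)) -> l2 (\sum_(i <- r | P i) F i).
Proof. by move=> FP; elim/big_ind: _ => //; [exact: l20|exact: l2D]. Qed.

Lemma cvg_sq x : l2 x -> bsum (fun n => x n * x n) @ \oo --> sq x.
Proof.
move=> [C xC]; apply: nondecreasing_is_cvgn.
  by apply: nondecreasing_bsum => n; rewrite -expr2 sqr_ge0.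
by exists C => _ [N _ <-]; have := xC N; under eq_bsum do rewrite expr2.
Qed.

(* Polarization reduces convergence of the mixed sums to monotone ones. *)
Lemma cvg_ip x y : l2 x -> l2 y -> bsum (fun n => x n * y n) @ \oo --> ip x y.
Proof.
move=> lx ly; suff : cvgn (bsum (fun n => x n * y n)) by [].
have -> : bsum (fun n => x n * y n) =
   (fun N => 2^-1 * (bsum (fun n => (x + y) n * (x + y) n) N -
             (bsum (fun n => x n * x n) N + bsum (fun n => y n * y n) N))).
  apply/funext => N; rewrite -bsumD -mulN1r -bsumZ -bsumD -bsumZ.
  by apply: eq_bsum => n; rewrite fctE; field.
apply: is_cvgZr; apply: is_cvgB; last apply: is_cvgD.
- by apply: cvgP; apply: cvg_sq; apply: l2D.
- by apply: cvgP; apply: cvg_sq.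
- by apply: cvgP; apply: cvg_sq.
Qed.

Lemma ip_eq x y l : l2 x -> l2 y ->
  bsum (fun n => x n * y n) @ \oo --> l -> ip x y = l.
Proof. by move=> lx ly h; apply: (cvg_unique _ (cvg_ip lx ly) h). Qed.

Lemma ipC x y : ip x y = ip y x.
Proof.
rewrite /ip (_ : (fun n => x n * y n) = (fun n => y n * x n)) //.
by apply/funext => n; rewrite mulrC.
Qed.

Lemma ipDl x y z : l2 x -> l2 y -> l2 z -> ip (x + y) z = ip x z + ip y z.
Proof.
move=> lx ly lz; apply: ip_eq => //; first exact: l2D.
have -> : bsum (fun n => (x + y) n * z n) =
    bsum (fun n => x n * z n) \+ bsum (fun n => y n * z n).
  by apply/funext => N; rewrite /= -bsumD; apply: eq_bsum => n; rewrite -mulrDl.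
by apply: cvgD; apply: cvg_ip.
Qed.

Lemma ipZl a x z : l2 x -> l2 z -> ip (a *: x) z = a * ip x z.
Proof.
move=> lx lz; apply: ip_eq => //; first exact: l2Z.
have -> : bsum (fun n => (a *: x) n * z n) = (fun N => a * bsum (fun n => x n * z n) N).
  by apply/funext => N; rewrite /= -bsumZ; apply: eq_bsum => n; rewrite mulrA.
by apply: cvgMr; apply: cvg_ip.
Qed.

Lemma ipNl x z : l2 x -> l2 z -> ip (- x) z = - ip x z.
Proof. by move=> lx lz; rewrite -scaleN1r ipZl // mulN1r. Qed.

Lemma ipBl x y z : l2 x -> l2 y -> l2 z -> ip (x - y) z = ip x z - ip y z.
Proof. by move=> lx ly lz; rewrite ipDl ?ipNl//; apply: l2N. Qed.

Lemma ipDr x y z : l2 x -> l2 y -> l2 z -> ip z (x + y) = ip z x + ip z y.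
Proof. by move=> *; rewrite ipC ipDl // ipC (ipC y). Qed.

Lemma ipZr a x z : l2 x -> l2 z -> ip z (a *: x) = a * ip z x.
Proof. by move=> *; rewrite ipC ipZl // ipC. Qed.

Lemma ipNr x z : l2 x -> l2 z -> ip z (- x) = - ip z x.
Proof. by move=> *; rewrite ipC ipNl // ipC. Qed.

Lemma ipBr x y z : l2 x -> l2 y -> l2 z -> ip z (x - y) = ip z x - ip z y.
Proof. by move=> *; rewrite ipC ipBl // ipC (ipC y). Qed.

Lemma ip0l z : ip 0 z = 0.
Proof.
rewrite /ip (_ : bsum _ = fun=> 0) ?lim_cst //.
by apply/funext => N; rewrite /bsum big1 // => n _; rewrite mul0r.
Qed.

Lemma ip_suml J (r : seq J) (F : J -> rfock R) z :
  (forall i, l2 (F i)) -> l2 z ->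
  ip (\sum_(i <- r) F i) z = \sum_(i <- r) ip (F i) z.
Proof.
move=> lF lz; elim: r => [|i r IH]; first by rewrite !big_nil ip0l.
by rewrite !big_cons ipDl ?IH //; apply: l2_sum => *; exact: lF.
Qed.

Lemma bsum_le_sq x N : l2 x -> bsum (fun n => x n ^+ 2) N <= sq x.
Proof.
move=> lx; rewrite -(cvg_lim (@Rhausdorff R) (cvg_sq lx)).
under eq_bsum do rewrite expr2.
apply: nondecreasing_cvgn_le; last by apply: cvgP; apply: cvg_sq.
by apply: nondecreasing_bsum => n; rewrite -expr2 sqr_ge0.
Qed.

Lemma sq_le x C : (forall N, bsum (fun n => x n ^+ 2) N <= C) -> sq x <= C.
Proof.
move=> xC; have lx : l2 x by exists C.
rewrite -(cvg_lim (@Rhausdorff R) (cvg_sq lx)).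
apply: limr_le; first by apply: cvgP; apply: cvg_sq.
by apply: nearW => N; have := xC N; under eq_bsum do rewrite expr2.
Qed.

Lemma sq_ge0 x : l2 x -> 0 <= sq x.
Proof.
move=> lx; apply: le_trans (bsum_le_sq 0 lx).
by apply: bsum_ge0 => n; rewrite sqr_ge0.
Qed.

Lemma sqr_le_sq x n : l2 x -> x n ^+ 2 <= sq x.
Proof.
move=> lx; apply: le_trans (bsum_le_sq (maxn n.1 n.2).+1 lx).
by apply: (@le_bsum_term _ (fun n => x n ^+ 2)) => [k||]; rewrite ?sqr_ge0 // ltnS ?leq_maxl ?leq_maxr.
Qed.

Lemma sq_eq0 x : l2 x -> sq x = 0 -> x = 0.
Proof.
move=> lx x0; apply/funext => n; apply/eqP; rewrite -sqrf_eq0 eq_le sqr_ge0 andbT.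
by rewrite -x0 sqr_le_sq.
Qed.

Lemma sqD x y : l2 x -> l2 y -> sq (x + y) = sq x + 2 * ip x y + sq y.
Proof.
move=> lx ly; have lxy := l2D lx ly.
by rewrite /sq ipDl // !ipDr // (ipC y x); ring.
Qed.

Lemma sqZ a x : l2 x -> sq (a *: x) = a ^+ 2 * sq x.
Proof. by move=> lx; rewrite /sq ipZl ?ipZr //; [ring|exact: l2Z]. Qed.

Lemma sqB x y : l2 x -> l2 y -> sq (x - y) = sq x - 2 * ip x y + sq y.
Proof.
move=> lx ly; rewrite sqD ?ipNr //; last exact: l2N.
by rewrite -(scaleN1r y) sqZ //; ring.
Qed.

Lemma cauchy_schwarz x y : l2 x -> l2 y -> ip x y ^+ 2 <= sq x * sq y.
Proof.
move=> lx ly; apply: discriminant_le0 => t.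
have := sq_ge0 (l2D (l2Z t lx) ly).
by rewrite sqD ?sqZ ?ipZl //; [lra|exact: l2Z].
Qed.

Lemma l2_trunc N x : l2 (trunc N x).
Proof.
exists (bsum (fun n => trunc N x n ^+ 2) N) => M.
have supp n : trunc N x n ^+ 2 != 0 -> ((n.1 < N) && (n.2 < N))%N.
  by rewrite /trunc; case: ifP => // _; rewrite expr0n eqxx.
have [NM|/ltnW MN] := leqP N M; first by rewrite (bsum_stationary supp NM).
by apply: nondecreasing_bsum MN => n; exact: sqr_ge0.
Qed.

Lemma ip_truncl N x y : l2 y -> ip (trunc N x) y = bsum (fun n => x n * y n) N.
Proof.
move=> ly; apply: ip_eq => //; first exact: l2_trunc.
apply: cvg_near_cst; near=> M; rewrite (@bsum_stationary _ _ N).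
- by apply: eq_bigr => n _; rewrite /trunc /= !ltn_ord.
- by move=> n; rewrite /trunc; case: ifP => // _; rewrite mul0r eqxx.
- by near: M; exact: nbhs_infty_ge.
Unshelve. all: end_near. Qed.

Lemma sq_sub_trunc N x : l2 x ->
  sq (x - trunc N x) = sq x - bsum (fun n => x n * x n) N.
Proof.
move=> lx; rewrite sqB //; last exact: l2_trunc.
rewrite ipC ip_truncl // {2}/sq ip_truncl; last exact: l2_trunc.
rewrite (_ : bsum _ N = bsum (fun n => x n * x n) N); first by ring.
by apply: eq_bigr => n _; rewrite /trunc /= !ltn_ord.
Qed.

Lemma cvg_sub_trunc x : l2 x -> (fun N => sq (x - trunc N x)) @ \oo --> (0 : R).
Proof.
move=> lx; rewrite -(subrr (sq x)); under eq_fun do rewrite sq_sub_trunc //.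
by apply: cvgB; [exact: cvg_cst|exact: cvg_sq].
Qed.

Lemma cvg_ip_trunc x y : l2 x -> l2 y -> (fun N => ip (trunc N x) y) @ \oo --> ip x y.
Proof. by move=> lx ly; under eq_fun do rewrite ip_truncl //; apply: cvg_ip. Qed.

(** Number states are truncations, so their square summability and their inner products are the
    finite computations made for [trunc]. *)
Lemma rket_trunc m : rket m = trunc (maxn m.1 m.2).+1 (rket m).
Proof.
apply/funext => n; rewrite /trunc /rket; case: eqVneq => [->|_] /=; last by case: ifP.
by rewrite !ltnS leq_maxl leq_maxr.
Qed.

Lemma l2_rket m : l2 (rket m).
Proof. by rewrite rket_trunc; apply: l2_trunc. Qed.

Lemma ip_rketl m x : l2 x -> ip (rket m) x = x m.
Proof.
move=> lx; rewrite rket_trunc ip_truncl //; set N := _.+1.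
have m1 : (m.1 < N)%N by rewrite ltnS leq_maxl.
have m2 : (m.2 < N)%N by rewrite ltnS leq_maxr.
rewrite /bsum (bigD1 (Ordinal m1, Ordinal m2)) //= -surjective_pairing.
rewrite /rket eqxx mul1r big1 ?addr0 // => -[[i iN] [j jN]] /= ne.
case: eqVneq => [mE|_]; last by rewrite mul0r.
by case/eqP: ne; congr (_, _); apply: val_inj; rewrite /= -mE.
Qed.

Lemma ip_rketr m x : l2 x -> ip x (rket m) = x m.
Proof. by move=> ?; rewrite ipC ip_rketl. Qed.

Lemma sq_rket m : sq (rket m) = 1.
Proof. by rewrite /sq ip_rketl ?/rket ?eqxx //; apply: l2_rket. Qed.

(** Expand the squared norm of [x - p], where [p] is the projection of [x] on the [e m] of a box.
    For the rows of the squeezing matrix this shows that the matrix maps [l2] to itself without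
    increasing norms. *)
Lemma bessel (e : nat * nat -> rfock R) x : (forall m, l2 (e m)) ->
    (forall m n, ip (e m) (e n) = (m == n)%:R) -> l2 x ->
  forall N, bsum (fun m => ip (e m) x ^+ 2) N <= sq x.
Proof.
move=> le oe lx N; pose k (i : 'I_N * 'I_N) := (val i.1, val i.2).
have injk : injective k.
  by move=> [i j] [i' j'] [/val_inj-> /val_inj->].
pose p : rfock R := \sum_i ip (e (k i)) x *: e (k i).
have lp : l2 p by apply: l2_sum => i _; apply: l2Z.
have px : ip p x = bsum (fun m => ip (e m) x ^+ 2) N.
  rewrite ip_suml //; last by move=> i; apply: l2Z.
  by apply: eq_bigr => i _; rewrite ipZl // expr2.
have pe i : ip p (e (k i)) = ip (e (k i)) x.
  rewrite ip_suml //; last by move=> j; apply: l2Z.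
  rewrite (bigD1 i) //= ipZl // oe eqxx mulr1 big1 ?addr0 // => j ji.
  by rewrite ipZl // oe (inj_eq injk) (negbTE ji) mulr0.
have pp : sq p = ip p x.
  rewrite {1}/sq {1}/p ip_suml //; last by move=> i; apply: l2Z.
  rewrite px; apply: eq_bigr => i _; by rewrite ipZl // (ipC _ p) pe expr2.
have := sq_ge0 (l2B lx lp); rewrite sqB // pp (ipC x) -px; lra.
Qed.

End RealHilbert.

(** * Bogoliubov operators and squeezed number states *)

Section HyperbolicTheory.
Variable R : realType.
Implicit Types r s : R.

Lemma cosh_gt0 r : 0 < cosh r.
Proof. by rewrite divr_gt0 // addr_gt0 ?expR_gt0. Qed.

Lemma cosh_neq0 r : cosh r != 0.
Proof. by rewrite gt_eqF // cosh_gt0. Qed.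

Lemma coshN r : cosh (- r) = cosh r.
Proof. by rewrite /cosh opprK addrC. Qed.

Lemma sinhN r : sinh (- r) = - sinh r.
Proof. by rewrite /sinh opprK -mulNr opprB. Qed.

Lemma cosh0 : cosh (0 : R) = 1.
Proof. by rewrite /cosh oppr0 expR0 divff. Qed.

Lemma sinh0 : sinh (0 : R) = 0.
Proof. by rewrite /sinh oppr0 subrr mul0r. Qed.

Lemma coshD r s : cosh (r + s) = cosh r * cosh s + sinh r * sinh s.
Proof. by rewrite /cosh /sinh opprD !expRD; field. Qed.

Lemma sinhD r s : sinh (r + s) = sinh r * cosh s + cosh r * sinh s.
Proof. by rewrite /cosh /sinh opprD !expRD; field. Qed.

Lemma cosh2Bsinh2 r : cosh r ^+ 2 - sinh r ^+ 2 = 1.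
Proof. by have := coshD r (- r); rewrite subrr cosh0 coshN sinhN mulrN -!expr2. Qed.

Lemma is_derive_cosh r : is_derive r 1 (@cosh R) (sinh r).
Proof.
rewrite /cosh /sinh; apply: is_derive_eq.
by rewrite /GRing.scale /=; field.
Qed.

Lemma is_derive_sinh r : is_derive r 1 (@sinh R) (cosh r).
Proof.
rewrite /cosh /sinh; apply: is_derive_eq.
by rewrite /GRing.scale /=; field.
Qed.

Lemma sinh2 r : sinh (2 * r) = 2 * cosh r * sinh r.
Proof. by rewrite mulr_natl mulr2n sinhD; ring. Qed.

Lemma cosh2 r : cosh (2 * r) = cosh r ^+ 2 + sinh r ^+ 2.
Proof. by rewrite mulr_natl mulr2n coshD -!expr2. Qed.

Lemma sinh_eq0 r : sinh r = 0 -> r = 0.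
Proof.
move=> /eqP; rewrite /sinh mulf_eq0 invr_eq0 pnatr_eq0 orbF subr_eq0 => /eqP/expR_inj.
lra.
Qed.

Definition tanh r := sinh r / cosh r.

Lemma cosh_tanh r : cosh r * tanh r = sinh r.
Proof. by rewrite /tanh mulrC divfK // cosh_neq0. Qed.

Lemma tanh_lt1 r : `|tanh r| < 1.
Proof.
rewrite -(@ltr_pXn2r _ 2) ?nnegrE // expr1n real_normK ?num_real //.
rewrite -(@ltr_pM2l _ (cosh r ^+ 2)) ?exprn_gt0 ?cosh_gt0 //.
by rewrite -exprMn cosh_tanh mulr1; have := cosh2Bsinh2 r; lra.
Qed.

End HyperbolicTheory.

(** * Ladder operators and their Bogoliubov transforms *)

Section RealLadder.
Variable R : realType.
Implicit Types x y z : rfock R.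

Definition rb1 x : rfock R := fun n => Num.sqrt n.1.+1%:R * x (n.1.+1, n.2).
Definition rb2 x : rfock R := fun n => Num.sqrt n.2.+1%:R * x (n.1, n.2.+1).
Definition rb1d x : rfock R := fun n => Num.sqrt n.1%:R * x (n.1.-1, n.2).
Definition rb2d x : rfock R := fun n => Num.sqrt n.2%:R * x (n.1, n.2.-1).

Fact rb1_is_linear : linear rb1.
Proof. by move=> a x y; apply/funext => n; rewrite /rb1 !fctE /GRing.scale /=; ring. Qed.
HB.instance Definition _ := GRing.isLinear.Build R (rfock R) (rfock R) _ rb1 rb1_is_linear.
Fact rb2_is_linear : linear rb2.
Proof. by move=> a x y; apply/funext => n; rewrite /rb2 !fctE /GRing.scale /=; ring. Qed.
HB.instance Definition _ := GRing.isLinear.Build R (rfock R) (rfock R) _ rb2 rb2_is_linear.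
Fact rb1d_is_linear : linear rb1d.
Proof. by move=> a x y; apply/funext => n; rewrite /rb1d !fctE /GRing.scale /=; ring. Qed.
HB.instance Definition _ := GRing.isLinear.Build R (rfock R) (rfock R) _ rb1d rb1d_is_linear.
Fact rb2d_is_linear : linear rb2d.
Proof. by move=> a x y; apply/funext => n; rewrite /rb2d !fctE /GRing.scale /=; ring. Qed.
HB.instance Definition _ := GRing.isLinear.Build R (rfock R) (rfock R) _ rb2d rb2d_is_linear.

Lemma sqrt_natK (n : nat) : Num.sqrt n%:R * Num.sqrt n%:R = n%:R :> R.
Proof. by rewrite -expr2 sqr_sqrtr. Qed.

Lemma sqrt_nat_scaleK (n : nat) x :
  Num.sqrt n%:R *: (Num.sqrt n%:R *: x) = n%:R *: x.
Proof. by rewrite scalerA sqrt_natK. Qed.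

Lemma rb1d_rb1 x n : rb1d (rb1 x) n = n.1%:R * x n.
Proof.
case: n => [[|i] j]; first by rewrite /rb1d /= sqrtr0 !mul0r.
by rewrite /rb1d /rb1 /= mulrA sqrt_natK.
Qed.

Lemma rb2d_rb2 x n : rb2d (rb2 x) n = n.2%:R * x n.
Proof.
case: n => [i [|j]]; first by rewrite /rb2d /= sqrtr0 !mul0r.
by rewrite /rb2d /rb2 /= mulrA sqrt_natK.
Qed.

Lemma rb1_rb1d x : rb1 (rb1d x) = rb1d (rb1 x) + x.
Proof.
apply/funext => -[i j]; rewrite !fctE rb1d_rb1 /rb1 /rb1d /= mulrA sqrt_natK.
by rewrite -natr1; ring.
Qed.

Lemma rb2_rb2d x : rb2 (rb2d x) = rb2d (rb2 x) + x.
Proof.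
apply/funext => -[i j]; rewrite !fctE rb2d_rb2 /rb2 /rb2d /= mulrA sqrt_natK.
by rewrite -natr1; ring.
Qed.

Lemma rb2_rb1 x : rb2 (rb1 x) = rb1 (rb2 x).
Proof. by apply/funext => n; rewrite /rb1 /rb2 /= mulrCA. Qed.
Lemma rb1_rb2d x : rb1 (rb2d x) = rb2d (rb1 x).
Proof. by apply/funext => n; rewrite /rb1 /rb2d /= mulrCA. Qed.
Lemma rb2_rb1d x : rb2 (rb1d x) = rb1d (rb2 x).
Proof. by apply/funext => n; rewrite /rb1d /rb2 /= mulrCA. Qed.
Lemma rb2d_rb1d x : rb2d (rb1d x) = rb1d (rb2d x).
Proof. by apply/funext => n; rewrite /rb1d /rb2d /= mulrCA. Qed.

(** Oriented towards the order b1^dagger, b2^dagger, b1, b2: every word reaches a normal form, after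
    which operator identities are ring identities between coefficients. *)
Definition rccr := (rb1_rb1d, rb2_rb2d, rb2_rb1, rb1_rb2d, rb2_rb1d, rb2d_rb1d).

(* The conjugates U(r) a U(r)^-1 of the ladder operators (Bogoliubov transformation). *)
Definition A1 (r : R) x : rfock R := cosh r *: rb1 x - sinh r *: rb2d x.
Definition A2 (r : R) x : rfock R := cosh r *: rb2 x - sinh r *: rb1d x.
Definition A1d (r : R) x : rfock R := cosh r *: rb1d x - sinh r *: rb2 x.
Definition A2d (r : R) x : rfock R := cosh r *: rb2d x - sinh r *: rb1 x.

Ltac lin := move=> a x y; rewrite /A1 /A2 /A1d /A2d !linearP /=;
  apply/funext => n; rewrite !fctE /GRing.scale /=; ring.
Fact A1_is_linear r : linear (A1 r). Proof. lin. Qed.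
HB.instance Definition _ r := GRing.isLinear.Build R (rfock R) (rfock R) _ (A1 r) (A1_is_linear r).
Fact A2_is_linear r : linear (A2 r). Proof. lin. Qed.
HB.instance Definition _ r := GRing.isLinear.Build R (rfock R) (rfock R) _ (A2 r) (A2_is_linear r).
Fact A1d_is_linear r : linear (A1d r). Proof. lin. Qed.
HB.instance Definition _ r := GRing.isLinear.Build R (rfock R) (rfock R) _ (A1d r) (A1d_is_linear r).
Fact A2d_is_linear r : linear (A2d r). Proof. lin. Qed.
HB.instance Definition _ r := GRing.isLinear.Build R (rfock R) (rfock R) _ (A2d r) (A2d_is_linear r).

Lemma rb1_comb a b x y : rb1 (a *: x - b *: y) = a *: rb1 x - b *: rb1 y.
Proof. by rewrite linearB !linearZ. Qed.
Lemma rb2_comb a b x y : rb2 (a *: x - b *: y) = a *: rb2 x - b *: rb2 y.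
Proof. by rewrite linearB !linearZ. Qed.
Lemma rb1d_comb a b x y : rb1d (a *: x - b *: y) = a *: rb1d x - b *: rb1d y.
Proof. by rewrite linearB !linearZ. Qed.
Lemma rb2d_comb a b x y : rb2d (a *: x - b *: y) = a *: rb2d x - b *: rb2d y.
Proof. by rewrite linearB !linearZ. Qed.

Lemma rb1_add x y : rb1 (x + y) = rb1 x + rb1 y.
Proof. exact: linearD. Qed.
Lemma rb1_sub x y : rb1 (x - y) = rb1 x - rb1 y.
Proof. exact: linearB. Qed.
Lemma rb2_add x y : rb2 (x + y) = rb2 x + rb2 y.
Proof. exact: linearD. Qed.
Lemma rb2_sub x y : rb2 (x - y) = rb2 x - rb2 y.
Proof. exact: linearB. Qed.
Lemma rb1d_add x y : rb1d (x + y) = rb1d x + rb1d y.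
Proof. exact: linearD. Qed.
Lemma rb1d_sub x y : rb1d (x - y) = rb1d x - rb1d y.
Proof. exact: linearB. Qed.
Lemma rb2d_add x y : rb2d (x + y) = rb2d x + rb2d y.
Proof. exact: linearD. Qed.
Lemma rb2d_sub x y : rb2d (x - y) = rb2d x - rb2d y.
Proof. exact: linearB. Qed.

Definition rladder_lin := (rb1_comb, rb2_comb, rb1d_comb, rb2d_comb,
  rb1_sub, rb2_sub, rb1d_sub, rb2d_sub, rb1_add, rb2_add, rb1d_add, rb2d_add).

Ltac normal_order := rewrite /A1 /A2 /A1d /A2d
  ?rladder_lin ?rccr;
  apply/funext => n; rewrite !fctE /GRing.scale /=.

Lemma A1_A1d r x : A1 r (A1d r x) = A1d r (A1 r x) + x.
Proof. by normal_order; rewrite -[X in _ = _ + X]mul1r -(cosh2Bsinh2 r); ring. Qed.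
Lemma A2_A2d r x : A2 r (A2d r x) = A2d r (A2 r x) + x.
Proof. by normal_order; rewrite -[X in _ = _ + X]mul1r -(cosh2Bsinh2 r); ring. Qed.
Lemma A1_A2d r x : A1 r (A2d r x) = A2d r (A1 r x).
Proof. by normal_order; ring. Qed.
Lemma A2_A1d r x : A2 r (A1d r x) = A1d r (A2 r x).
Proof. by normal_order; ring. Qed.
Lemma A2d_A1d r x : A2d r (A1d r x) = A1d r (A2d r x).
Proof. by normal_order; ring. Qed.

(** The inverse Bogoliubov transformation, whose determinant is cosh^2 - sinh^2 = 1. It lets a plain
    ladder operator act on [sqket r m] by shifting [m]. *)
Lemma rb1E r x : rb1 x = cosh r *: A1 r x + sinh r *: A2d r x.
Proof. by normal_order; rewrite -[LHS]mul1r -(cosh2Bsinh2 r); ring. Qed.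
Lemma rb2E r x : rb2 x = cosh r *: A2 r x + sinh r *: A1d r x.
Proof. by normal_order; rewrite -[LHS]mul1r -(cosh2Bsinh2 r); ring. Qed.
Lemma rb1dE r x : rb1d x = cosh r *: A1d r x + sinh r *: A2 r x.
Proof. by normal_order; rewrite -[LHS]mul1r -(cosh2Bsinh2 r); ring. Qed.
Lemma rb2dE r x : rb2d x = cosh r *: A2d r x + sinh r *: A1 r x.
Proof. by normal_order; rewrite -[LHS]mul1r -(cosh2Bsinh2 r); ring. Qed.

(* The squeezed vacuum U(r)|0,0>. *)
Definition sqvac (r : R) : rfock R :=
  fun n => if n.1 == n.2 then tanh r ^+ n.1 / cosh r else 0.

Lemma A1_sqvac r : A1 r (sqvac r) = 0.
Proof.
apply/funext => -[i j]; rewrite -[RHS]/(0 : R) /A1 /sqvac !fctE /GRing.scale /= /rb1 /rb2d /=.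
case: j => [|j] /=; first by rewrite sqrtr0 mul0r !mulr0 subr0.
rewrite eqSS; case: eqP => [->|_]; last by ring.
by rewrite exprS -(cosh_tanh r); ring.
Qed.

Lemma A2_sqvac r : A2 r (sqvac r) = 0.
Proof.
apply/funext => -[j i]; rewrite -[RHS]/(0 : R) /A2 /sqvac !fctE /GRing.scale /= /rb2 /rb1d /=.
case: j => [|j] /=; first by rewrite sqrtr0 mul0r !mulr0 subr0.
rewrite eqSS; case: eqP => [->|_]; last by ring.
by rewrite exprS -(cosh_tanh r); ring.
Qed.

Lemma sqrtS_neq0 (n : nat) : Num.sqrt n.+1%:R != 0 :> R.
Proof. by rewrite sqrtr_eq0 -ltNge ltr0n. Qed.

Lemma rfock0P x n : x = 0 -> x n = 0.
Proof. by move->. Qed.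

Lemma mul2_eq0 (a b c : R) : a != 0 -> b != 0 -> a * (b * c) = 0 -> c = 0.
Proof.
by move=> a0 b0 /eqP; rewrite mulrA mulf_eq0 mulf_eq0 (negbTE a0) (negbTE b0) => /eqP.
Qed.

(** On the two axes the creation term drops out, so [x] vanishes there except at the origin. The
    first equation then propagates along each diagonal: zero off the main one, a geometric sequence
    of ratio tanh r on it. *)
Lemma annihilated_sqvac r x : A1 r x = 0 -> A2 r x = 0 ->
  x = (cosh r * x (0, 0)%N) *: sqvac r.
Proof.
move=> h1 h2.
have e1 i : x (i.+1, 0)%N = 0.
  have := rfock0P (i, 0)%N h1.
  rewrite /A1 !fctE /GRing.scale /= /rb1 /rb2d /= sqrtr0 mul0r mulr0 subr0.
  exact: mul2_eq0 (cosh_neq0 r) (sqrtS_neq0 _).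
have e2 j : x (0, j.+1)%N = 0.
  have := rfock0P (0, j)%N h2.
  rewrite /A2 !fctE /GRing.scale /= /rb2 /rb1d /= sqrtr0 mul0r mulr0 subr0.
  exact: mul2_eq0 (cosh_neq0 r) (sqrtS_neq0 _).
have e3 i j : cosh r * (Num.sqrt i.+1%:R * x (i.+1, j.+1)) =
    sinh r * (Num.sqrt j.+1%:R * x (i, j)).
  have := rfock0P (i, j.+1)%N h1.
  by rewrite /A1 !fctE /GRing.scale /= /rb1 /rb2d /= => /subr0_eq.
apply/funext => -[i j]; rewrite !fctE /GRing.scale /= /sqvac /=.
elim: i j => [|i IH] [|j] //=.
- by rewrite expr0; field; rewrite cosh_neq0.
- by rewrite e2 mulr0.
- by rewrite e1 mulr0.
have hn : cosh r * Num.sqrt i.+1%:R != 0 by rewrite mulf_neq0 ?cosh_neq0 ?sqrtS_neq0.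
apply: (mulfI hn); rewrite -mulrA e3 IH eqSS.
case: eqP => [->|_]; last by ring.
by rewrite exprS -(cosh_tanh r); ring.
Qed.

End RealLadder.

(* Locked: otherwise rewriting with the linearity lemmas unfolds it. *)
HB.lock Definition sqket (R : realType) (r : R) (m : nat * nat) : rfock R :=
  (Num.sqrt (m.1`! * m.2`!)%:R)^-1 *: iter m.1 (A1d r) (iter m.2 (A2d r) (sqvac r)).

(** * Squeezed number states *)

Section SqueezedStates.
Variable R : realType.
Implicit Types x : rfock R.

Lemma sqket00 (r : R) : sqket r (0, 0)%N = sqvac r.
Proof. by rewrite sqket.unlock /= mul1n sqrtr1 invr1 scale1r. Qed.

Lemma A2d_iter_A1d r k x : A2d r (iter k (A1d r) x) = iter k (A1d r) (A2d r x).
Proof. by elim: k => //= k IH; rewrite A2d_A1d IH. Qed.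

Lemma A1d_sqket (r : R) i j : A1d r (sqket r (i, j)) = Num.sqrt i.+1%:R *: sqket r (i.+1, j).
Proof.
rewrite sqket.unlock /= linearZ /= scalerA; congr (_ *: _).
have f0 : Num.sqrt (i`! * j`!)%:R != 0 :> R.
  by rewrite sqrtr_eq0 -ltNge ltr0n muln_gt0 !fact_gt0.
by rewrite factS -mulnA (natrM _ i.+1) sqrtrM //; field; rewrite f0 sqrtS_neq0.
Qed.

Lemma A2d_sqket (r : R) i j : A2d r (sqket r (i, j)) = Num.sqrt j.+1%:R *: sqket r (i, j.+1).
Proof.
rewrite sqket.unlock /= linearZ /= A2d_iter_A1d scalerA; congr (_ *: _).
have f0 : Num.sqrt (i`! * j`!)%:R != 0 :> R.
  by rewrite sqrtr_eq0 -ltNge ltr0n muln_gt0 !fact_gt0.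
by rewrite factS mulnCA (natrM _ j.+1) sqrtrM //; field; rewrite f0 sqrtS_neq0.
Qed.

Lemma A1_sqket (r : R) i j : A1 r (sqket r (i, j)) = Num.sqrt i%:R *: sqket r (i.-1, j).
Proof.
elim: i => [|i IH].
  rewrite sqrtr0 scale0r; elim: j => [|j IH]; first by rewrite sqket00 A1_sqvac.
  apply: (scalerI (sqrtS_neq0 R j)); rewrite -linearZ -A2d_sqket /= A1_A2d IH.
  by rewrite linear0 scaler0.
apply: (scalerI (sqrtS_neq0 R i)); rewrite -linearZ -A1d_sqket /= A1_A1d IH linearZ /=.
case: i {IH} => [|i] /=; first by rewrite sqrtr0 scale0r add0r sqrt_nat_scaleK scale1r.
by rewrite A1d_sqket !sqrt_nat_scaleK -[X in _ + X = _]scale1r -scalerDl natr1.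
Qed.

Lemma A2_sqket (r : R) i j : A2 r (sqket r (i, j)) = Num.sqrt j%:R *: sqket r (i, j.-1).
Proof.
elim: j => [|j IH].
  rewrite sqrtr0 scale0r; elim: i => [|i IH]; first by rewrite sqket00 A2_sqvac.
  apply: (scalerI (sqrtS_neq0 R i)); rewrite -linearZ -A1d_sqket /= A2_A1d IH.
  by rewrite linear0 scaler0.
apply: (scalerI (sqrtS_neq0 R j)); rewrite -linearZ -A2d_sqket /= A2_A2d IH linearZ /=.
case: j {IH} => [|j] /=; first by rewrite sqrtr0 scale0r add0r sqrt_nat_scaleK scale1r.
by rewrite A2d_sqket !sqrt_nat_scaleK -[X in _ + X = _]scale1r -scalerDl natr1.
Qed.

Lemma sqket0 m : sqket (0 : R) m = rket R m.
Proof.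
case: m => i j; elim: i => [|i IH].
  elim: j => [|j IH].
    rewrite sqket00; apply/funext => -[i j]; rewrite /sqvac /rket /= xpair_eqE.
    rewrite /tanh sinh0 mul0r cosh0 divr1 expr0n.
    by case: eqVneq => [<-|]; case: i => [|i]; case: j => [|j].
  apply: (scalerI (sqrtS_neq0 R j)); rewrite -A2d_sqket IH /A2d cosh0 sinh0 scale1r scale0r subr0.
  apply/funext => -[i k]; rewrite /rb2d /rket !fctE /GRing.scale /= !xpair_eqE.
  case: k => [|k] /=; first by rewrite sqrtr0 mul0r andbF mulr0.
  by rewrite eqSS; case: (eqVneq k j) => [->//|]; rewrite andbF !mulr0.
apply: (scalerI (sqrtS_neq0 R i)); rewrite -A1d_sqket IH /A1d cosh0 sinh0 scale1r scale0r subr0.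
apply/funext => -[k l]; rewrite /rb1d /rket !fctE /GRing.scale /= !xpair_eqE.
case: k => [|k] /=; first by rewrite sqrtr0 mul0r mulr0.
by rewrite eqSS; case: (eqVneq k i) => [->//|]; rewrite !mulr0.
Qed.

End SqueezedStates.

(** * Rapid decrease and the squeezing matrix *)

Section Rapid.
Variable R : realType.
Implicit Types x y : rfock R.

(** Telescoping, since 1 / a^2 <= 2 / a - 2 / (a + 1) for a >= 1. *)
Lemma sum_inv_sqr_le2 N : \sum_(i < N) (i.+1%:R ^+ 2)^-1 <= 2 :> R.
Proof.
suff : \sum_(i < N) (i.+1%:R ^+ 2)^-1 <= 2 - 2 / N.+1%:R :> R.
  by move=> h; apply: le_trans h _; rewrite gerBl divr_ge0.
elim: N => [|N IH]; first by rewrite big_ord0 divr1 subrr.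
rewrite big_ord_recr /= -[N.+2%:R]natr1; set a : R := N.+1%:R in IH *.
have a1 : 1 <= a by rewrite ler1n.
have : 0 <= (a - 1) / (a ^+ 2 * (a + 1)).
  by rewrite divr_ge0 ?subr_ge0 // mulr_ge0 ?sqr_ge0 //; lra.
have -> : (a - 1) / (a ^+ 2 * (a + 1)) = (2 / a - 2 / (a + 1)) - (a ^+ 2)^-1.
  by field; apply/andP; split; lra.
move=> h; apply: le_trans (lerD IH (lexx _)) _; rewrite -subr_ge0.
by apply: le_trans h _; rewrite le_eqVlt; apply/orP; left; apply/eqP; ring.
Qed.

Lemma sqrt_nat_le (n : nat) : Num.sqrt n%:R <= n%:R :> R.
Proof.
rewrite -[leRHS]ger0_norm // -sqrtr_sqr; apply: ler_wsqrtr.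
by rewrite -natrX ler_nat; case: n => // n; rewrite leq_pmulr.
Qed.

(** The Schwartz space of sequences: an invariant domain common to all ladder operators. The
    supremum form suits termwise estimates; [rapidP] identifies it with the domain of all powers of
    the number operator. *)
Definition rapid x := forall k, exists C : R,
  forall n, (n.1 + n.2).+1%:R ^+ k * `|x n| <= C.

Lemma rapid_bound x k : rapid x -> exists2 C : R, 0 <= C &
  forall n, (n.1 + n.2).+1%:R ^+ k * `|x n| <= C.
Proof.
by move=> /(_ k)[C hC]; exists C => //; apply: le_trans (hC (0, 0)%N); rewrite mulr_ge0.
Qed.

Lemma rapid0 : rapid 0.
Proof. by move=> k; exists 0 => n; rewrite normr0 mulr0. Qed.

Lemma rapidZ a x : rapid x -> rapid (a *: x).
Proof.
move=> hx k; have [C _ hC] := rapid_bound k hx.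
by exists (`|a| * C) => n; rewrite fctE normrM mulrCA ler_wpM2l.
Qed.

Lemma rapidD x y : rapid x -> rapid y -> rapid (x + y).
Proof.
move=> hx hy k; have [C hC] := hx k; have [D hD] := hy k.
exists (C + D) => n; apply: le_trans (lerD (hC n) (hD n)).
by rewrite -mulrDr ler_wpM2l // ler_normD.
Qed.

Lemma rapidB x y : rapid x -> rapid y -> rapid (x - y).
Proof. by move=> hx hy; rewrite -scaleN1r; apply/rapidD/rapidZ. Qed.

Lemma rapid_l2 x : rapid x -> l2 x.
Proof.
move=> hx; have [C C0 hC] := rapid_bound 2 hx.
(* (n1 + n2 + 1)^2 dominates (n1 + 1)(n2 + 1), so the squares are bounded by a product of two
   inverse squares, each of sum at most 2. *)
exists (C ^+ 2 * (2 * 2)) => N.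
pose u i : R := (i.+1%:R ^+ 2)^-1.
apply: (@le_trans _ _ (bsum (fun n => C ^+ 2 * (u n.1 * u n.2)) N)); last first.
  rewrite bsumZ bsumM ler_wpM2l ?sqr_ge0 // ler_pM ?sum_inv_sqr_le2 //;
  by apply: sumr_ge0 => i _; rewrite invr_ge0 sqr_ge0.
apply: ler_bsum => -[i j] /=; rewrite /u -invfM -exprMn.
rewrite ler_pdivlMr ?exprn_gt0 ?mulr_gt0 // -real_normK ?num_real // -exprMn.
rewrite ler_pXn2r ?nnegrE ?mulr_ge0 // mulrC; apply: le_trans (hC (i, j)) => /=.
by rewrite ler_wpM2r // expr2 ler_pM // ler_nat ltnS ?leq_addr ?leq_addl.
Qed.

(** The pattern common to the four ladder operators: a coefficient of [y] is controlled by one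
    neighbouring coefficient of [x], up to a power of the weight; the factor 2 absorbs the shift of
    the index. *)
Lemma rapid_weight x y k0 (D : R) :
    (forall n, exists2 n', `|y n| <= (n'.1 + n'.2).+1%:R ^+ k0 * `|x n'| &
        ((n.1 + n.2).+1%:R <= 2 * (n'.1 + n'.2).+1%:R :> R)) ->
  rapid x -> rapid y.
Proof.
move=> h hx k; have [C _ hC] := rapid_bound (k + k0) hx.
exists (2 ^+ k * C) => n; have [n' yn nn'] := h n.
apply: (@le_trans _ _ ((2 * (n'.1 + n'.2).+1%:R) ^+ k *
   ((n'.1 + n'.2).+1%:R ^+ k0 * `|x n'|))).
  by apply: ler_pM => //; rewrite ?exprn_ge0 // lerXn2r // nnegrE.
by rewrite exprMn -mulrA mulrA -mulrA ler_wpM2l ?exprn_ge0 // mulrA -exprD.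
Qed.

Lemma rapid_rb1 x : rapid x -> rapid (rb1 x).
Proof.
apply: (@rapid_weight _ _ 1 0) => -[i j]; exists (i.+1, j); rewrite /rb1 /=.
  rewrite normrM expr1 ler_wpM2r // ger0_norm ?sqrtr_ge0 //.
  by apply: le_trans (sqrt_nat_le _) _; rewrite ler_nat; lia.
by rewrite -natrM ler_nat; lia.
Qed.

Lemma rapid_rb2 x : rapid x -> rapid (rb2 x).
Proof.
apply: (@rapid_weight _ _ 1 0) => -[i j]; exists (i, j.+1); rewrite /rb2 /=.
  rewrite normrM expr1 ler_wpM2r // ger0_norm ?sqrtr_ge0 //.
  by apply: le_trans (sqrt_nat_le _) _; rewrite ler_nat; lia.
by rewrite -natrM ler_nat; lia.
Qed.

Lemma rapid_rb1d x : rapid x -> rapid (rb1d x).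
Proof.
apply: (@rapid_weight _ _ 1 0) => -[i j]; exists (i.-1, j); rewrite /rb1d /=.
  rewrite normrM expr1 ler_wpM2r // ger0_norm ?sqrtr_ge0 //.
  by apply: le_trans (sqrt_nat_le _) _; rewrite ler_nat; lia.
by rewrite -natrM ler_nat; lia.
Qed.

Lemma rapid_rb2d x : rapid x -> rapid (rb2d x).
Proof.
apply: (@rapid_weight _ _ 1 0) => -[i j]; exists (i, j.-1); rewrite /rb2d /=.
  rewrite normrM expr1 ler_wpM2r // ger0_norm ?sqrtr_ge0 //.
  by apply: le_trans (sqrt_nat_le _) _; rewrite ler_nat; lia.
by rewrite -natrM ler_nat; lia.
Qed.

Lemma rapid_A1 r x : rapid x -> rapid (A1 r x).
Proof. by move=> hx; apply/rapidB; apply: rapidZ; [exact: rapid_rb1|exact: rapid_rb2d]. Qed.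
Lemma rapid_A2 r x : rapid x -> rapid (A2 r x).
Proof. by move=> hx; apply/rapidB; apply: rapidZ; [exact: rapid_rb2|exact: rapid_rb1d]. Qed.
Lemma rapid_A1d r x : rapid x -> rapid (A1d r x).
Proof. by move=> hx; apply/rapidB; apply: rapidZ; [exact: rapid_rb1d|exact: rapid_rb2]. Qed.
Lemma rapid_A2d r x : rapid x -> rapid (A2d r x).
Proof. by move=> hx; apply/rapidB; apply: rapidZ; [exact: rapid_rb2d|exact: rapid_rb1]. Qed.

(** Write [q = p ^+ 2]: one factor [p ^+ k] absorbs one power of k, the other is left to the
    induction. *)
Lemma poly_geometric_bounded j (q : R) : 0 <= q < 1 ->
  exists C : R, forall k, k.+1%:R ^+ j * q ^+ k <= C.
Proof.
elim: j q => [|j IH] q /andP[q0 q1].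
  by exists 1 => k; rewrite expr0 mul1r exprn_ile1 // ltW.
pose p := Num.sqrt q; have p0 : 0 <= p := sqrtr_ge0 q.
have pq : p ^+ 2 = q by rewrite sqr_sqrtr.
have p1 : p < 1 by rewrite -(@ltr_pXn2r _ 2) ?nnegrE // pq expr1n.
have [|C hC] := IH p; first by rewrite p0.
(* Each of the k + 1 terms of the geometric sum of [p] is at least [p ^+ k]. *)
have h k : k.+1%:R * p ^+ k * (1 - p) <= 1 - p ^+ k.+1.
  elim: k => [|k IHk]; first by rewrite !mul1r expr1.
  have pk1 : p ^+ k.+1 <= 1 by rewrite exprn_ile1 // ltW.
  have pk0 : 0 <= p ^+ k.+1 by rewrite exprn_ge0.
  have -> : k.+2%:R * p ^+ k.+1 * (1 - p) =
     p * (k.+1%:R * p ^+ k * (1 - p)) + p ^+ k.+1 * (1 - p).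
    by rewrite -[k.+2%:R]natr1 exprS; ring.
  rewrite (exprS p k.+1); nra.
exists ((1 - p)^-1 * C) => k.
have -> : k.+1%:R ^+ j.+1 * q ^+ k = (k.+1%:R * p ^+ k) * (k.+1%:R ^+ j * p ^+ k).
  by rewrite -pq -exprM mulnC exprM exprS; ring.
apply: ler_pM => //; rewrite ?mulr_ge0 ?exprn_ge0 //.
rewrite -[leRHS]mul1r ler_pdivlMr ?subr_gt0 //; apply: le_trans (h k) _.
by rewrite gerBl exprn_ge0.
Qed.

Lemma rapid_sqvac r : rapid (sqvac r).
Proof.
move=> k; have [|C hC] := @poly_geometric_bounded k `|tanh r|.
  by rewrite normr_ge0 tanh_lt1.
have C0 : 0 <= C by apply: le_trans (hC 0%N); rewrite mulr_ge0 ?exprn_ge0.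
exists (2 ^+ k * C / cosh r) => -[i j]; rewrite /sqvac /=.
have ch0 := ltW (cosh_gt0 r).
case: eqP => [<-|_]; last by rewrite normr0 mulr0 divr_ge0 ?mulr_ge0 ?exprn_ge0.
rewrite normrM normfV (gtr0_norm (cosh_gt0 r)) mulrA ler_pM2r ?invr_gt0 ?cosh_gt0 //.
apply: (@le_trans _ _ (2 ^+ k * (i.+1%:R ^+ k * `|tanh r| ^+ i))).
  rewrite mulrA -exprMn normrX ler_wpM2r ?exprn_ge0 // lerXn2r ?nnegrE ?mulr_ge0 //.
  by rewrite -natrM ler_nat; lia.
by rewrite ler_wpM2l ?exprn_ge0.
Qed.

Lemma rapid_sqket r m : rapid (sqket r m).
Proof.
rewrite sqket.unlock; apply: rapidZ; elim: m.1 => [|i IH] /=; last exact: rapid_A1d.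
elim: m.2 => [|j IH] /=; last exact: rapid_A2d.
exact: rapid_sqvac.
Qed.

(** Summation by parts: on a box the two sums differ by the edge [T N], which tends to 0. *)
Lemma adjoint_rb1 x y : rapid x -> rapid y -> ip (rb1d x) y = ip x (rb1 y).
Proof.
move=> hx hy; have lx := rapid_l2 hx; have ly := rapid_l2 hy.
(* Three powers: one pays for the ladder factor, one for the N + 1 terms of the edge, and one is
   left for the decay. *)
have [C C0 hC] := rapid_bound 3 hx; have [D D0 hD] := rapid_bound 0 hy.
pose T N : R := \sum_(j < N.+1) Num.sqrt N.+1%:R * (x (N, val j) * y (N.+1, val j)).
have bE N : bsum (fun n => rb1d x n * y n) N.+1 =
    bsum (fun n => x n * rb1 y n) N.+1 - T N.
  rewrite !bsumE big_ord_recl /= big1 ?add0r; last first.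
    by move=> j _; rewrite /rb1d /= sqrtr0 !mul0r.
  rewrite [in RHS]big_ord_recr /= (_ : \sum_(j < N.+1) x (N, val j) * _ = T N).
    rewrite addrK; apply: eq_bigr => i _; apply: eq_bigr => j _.
    by rewrite /rb1d /rb1 /= /bump /= add1n /=; ring.
  by apply: eq_bigr => j _; rewrite /rb1 /=; ring.
have T0 : T @ \oo --> (0 : R).
  have hT N : `|T N| <= C * D * harmonic N.
    apply: le_trans (ler_norm_sum _ _ _) _.
    apply: (@le_trans _ _ (\sum_(j < N.+1) C * D / N.+1%:R ^+ 2)).
      apply: ler_sum => j _; rewrite !normrM ger0_norm ?sqrtr_ge0 //.
      rewrite ler_pdivlMr ?exprn_gt0 //.
      have hx' : N.+1%:R ^+ 3 * `|x (N, val j)| <= C.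
        apply: le_trans (hC (N, val j)); rewrite ler_wpM2r // lerXn2r ?nnegrE //=.
        by rewrite ler_nat ltnS leq_addr.
      have hy' : `|y (N.+1, val j)| <= D by rewrite -[leLHS]mul1r; exact: hD.
      apply: (@le_trans _ _ ((N.+1%:R ^+ 3 * `|x (N, val j)|) * `|y (N.+1, val j)|)).
        rewrite [leRHS](_ : _ = (N.+1%:R * (`|x (N, val j)| * `|y (N.+1, val j)|)) *
          N.+1%:R ^+ 2); last by ring.
        by rewrite ler_wpM2r ?exprn_ge0 // ler_wpM2r ?mulr_ge0 // sqrt_nat_le.
      by apply: ler_pM => //; rewrite mulr_ge0 ?exprn_ge0.
    rewrite sumr_const card_ord -[leLHS]mulr_natr /harmonic /=.
    have : N.+1%:R != 0 :> R by rewrite pnatr_eq0.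
    by move: (N.+1%:R : R) => a a0; rewrite le_eqVlt; apply/orP; left; apply/eqP; field.
  apply: norm_cvg0; apply: (@squeeze_cvgr _ _ _ _ (fun=> 0) (fun N => C * D * harmonic N)).
  - by apply: nearW => N; rewrite normr_ge0 hT.
  - exact: cvg_cst.
  - by rewrite -[X in _ --> X](mulr0 (C * D)); apply: cvgMr; exact: cvg_harmonic.
have ld := rapid_l2 (rapid_rb1d hx); have lr := rapid_l2 (rapid_rb1 hy).
have h : (fun N => bsum (fun n => x n * rb1 y n) N.+1) @ \oo --> ip x (rb1 y).
  by have := cvg_ip lx lr; rewrite -cvg_shiftS.
have {}h : (fun N => bsum (fun n => rb1d x n * y n) N.+1) @ \oo --> ip x (rb1 y) - 0.
  by under eq_fun do rewrite bE; apply: cvgB.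
by apply: ip_eq => //; rewrite -cvg_shiftS -[ip x _]subr0.
Qed.

(** Exchange of the two modes; it turns the adjoint relation of mode 1 into that of mode 2. *)
Definition swap x : rfock R := fun n => x (n.2, n.1).

Lemma ip_swap x y : ip (swap x) (swap y) = ip x y.
Proof.
rewrite /ip; congr (lim (_ @ \oo)); apply/funext => N.
by rewrite !bsumE exchange_big.
Qed.

Lemma rapid_swap x : rapid x -> rapid (swap x).
Proof.
move=> hx k; have [C hC] := hx k; exists C => n.
by have := hC (n.2, n.1); rewrite /= addnC.
Qed.

Lemma adjoint_rb2 x y : rapid x -> rapid y -> ip (rb2d x) y = ip x (rb2 y).
Proof.
move=> hx hy; rewrite -ip_swap -[RHS]ip_swap.
exact: (adjoint_rb1 (rapid_swap hx) (rapid_swap hy)).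
Qed.

End Rapid.

(** * The squeezing matrix is an orthogonal one-parameter group *)

Section Squeezing.
Variable R : realType.
Implicit Types x y : rfock R.

(* The columns of U(s) are the sqket s n; as its transpose is U(- s), its rows
   are the sqket (- s) m. *)
Definition rsqz (s : R) x : rfock R := fun m => ip (sqket (- s) m) x.

Let l2E r m := rapid_l2 (@rapid_sqket R r m).

Lemma rsqzZ s a x : l2 x -> rsqz s (a *: x) = a *: rsqz s x.
Proof. by move=> lx; apply/funext => m; rewrite /rsqz ipZr. Qed.

Lemma rsqzD s x y : l2 x -> l2 y -> rsqz s (x + y) = rsqz s x + rsqz s y.
Proof. by move=> lx ly; apply/funext => m; rewrite /rsqz ipDr. Qed.

Lemma rsqzB s x y : l2 x -> l2 y -> rsqz s (x - y) = rsqz s x - rsqz s y.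
Proof. by move=> lx ly; apply/funext => m; rewrite /rsqz ipBr. Qed.

Let ip2 a b x y z : rapid x -> rapid y -> rapid z ->
  ip (a *: x + b *: y) z = a * ip x z + b * ip y z.
Proof.
move=> /rapid_l2 ? /rapid_l2 ? /rapid_l2 ?.
by rewrite ipDl ?ipZl //; apply: l2Z.
Qed.

(** The adjoint acts on the row [sqket (- s) m], where the inverse Bogoliubov formula shifts [m];
    oddness of sinh at [- s] produces the minus sign of [A1 s]. *)
Lemma rsqz_rb1 s x : rapid x -> rsqz s (rb1 x) = A1 s (rsqz s x).
Proof.
move=> hx; apply/funext => -[i j]; rewrite /rsqz -adjoint_rb1 //; last exact: rapid_sqket.
rewrite (rb1dE (- s)) A1d_sqket A2_sqket ip2 //; try by [apply: rapidZ; apply: rapid_sqket|apply: rapid_sqket].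
rewrite !ipZl ?coshN ?sinhN //; try by [apply: rapid_l2].
by rewrite /A1 !fctE /GRing.scale /= /rb1 /rb2d /=; ring.
Qed.

Lemma rsqz_rb2 s x : rapid x -> rsqz s (rb2 x) = A2 s (rsqz s x).
Proof.
move=> hx; apply/funext => -[i j]; rewrite /rsqz -adjoint_rb2 //; last exact: rapid_sqket.
rewrite (rb2dE (- s)) A2d_sqket A1_sqket ip2 //; try by [apply: rapidZ; apply: rapid_sqket|apply: rapid_sqket].
rewrite !ipZl ?coshN ?sinhN //; try by [apply: rapid_l2].
by rewrite /A2 !fctE /GRing.scale /= /rb2 /rb1d /=; ring.
Qed.

Lemma rsqz_rb1d s x : rapid x -> rsqz s (rb1d x) = A1d s (rsqz s x).
Proof.
move=> hx; apply/funext => -[i j]; rewrite /rsqz ipC adjoint_rb1 //; last exact: rapid_sqket.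
rewrite ipC (rb1E (- s)) A1_sqket A2d_sqket ip2 //; try by [apply: rapidZ; apply: rapid_sqket|apply: rapid_sqket].
rewrite !ipZl ?coshN ?sinhN //; try by [apply: rapid_l2].
by rewrite /A1d !fctE /GRing.scale /= /rb1d /rb2 /=; ring.
Qed.

Lemma rsqz_rb2d s x : rapid x -> rsqz s (rb2d x) = A2d s (rsqz s x).
Proof.
move=> hx; apply/funext => -[i j]; rewrite /rsqz ipC adjoint_rb2 //; last exact: rapid_sqket.
rewrite ipC (rb2E (- s)) A2_sqket A1d_sqket ip2 //; try by [apply: rapidZ; apply: rapid_sqket|apply: rapid_sqket].
rewrite !ipZl ?coshN ?sinhN //; try by [apply: rapid_l2].
by rewrite /A2d !fctE /GRing.scale /= /rb2d /rb1 /=; ring.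
Qed.

Lemma rsqz_comb s a b x y : rapid x -> rapid y ->
  rsqz s (a *: x - b *: y) = a *: rsqz s x - b *: rsqz s y.
Proof.
move=> /rapid_l2 lx /rapid_l2 ly.
by rewrite (rsqzB s (l2Z a lx) (l2Z b ly)) (rsqzZ s a lx) (rsqzZ s b ly).
Qed.

(** The addition theorems: Bogoliubov transformations compose by adding parameters. *)
Lemma rsqz_A1 s r x : rapid x -> rsqz s (A1 r x) = A1 (r + s) (rsqz s x).
Proof.
move=> hx; rewrite [in LHS]/A1 (rsqz_comb _ _ _ (rapid_rb1 hx) (rapid_rb2d hx)).
rewrite (rsqz_rb1 _ hx) (rsqz_rb2d _ hx) /A1 /A2 /A1d /A2d coshD sinhD.
by apply/funext => n; rewrite !fctE /GRing.scale /=; ring.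
Qed.

Lemma rsqz_A2 s r x : rapid x -> rsqz s (A2 r x) = A2 (r + s) (rsqz s x).
Proof.
move=> hx; rewrite [in LHS]/A2 (rsqz_comb _ _ _ (rapid_rb2 hx) (rapid_rb1d hx)).
rewrite (rsqz_rb2 _ hx) (rsqz_rb1d _ hx) /A1 /A2 /A1d /A2d coshD sinhD.
by apply/funext => n; rewrite !fctE /GRing.scale /=; ring.
Qed.

Lemma rsqz_A1d s r x : rapid x -> rsqz s (A1d r x) = A1d (r + s) (rsqz s x).
Proof.
move=> hx; rewrite [in LHS]/A1d (rsqz_comb _ _ _ (rapid_rb1d hx) (rapid_rb2 hx)).
rewrite (rsqz_rb1d _ hx) (rsqz_rb2 _ hx) /A1 /A2 /A1d /A2d coshD sinhD.
by apply/funext => n; rewrite !fctE /GRing.scale /=; ring.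
Qed.

Lemma rsqz_A2d s r x : rapid x -> rsqz s (A2d r x) = A2d (r + s) (rsqz s x).
Proof.
move=> hx; rewrite [in LHS]/A2d (rsqz_comb _ _ _ (rapid_rb2d hx) (rapid_rb1 hx)).
rewrite (rsqz_rb2d _ hx) (rsqz_rb1 _ hx) /A1 /A2 /A1d /A2d coshD sinhD.
by apply/funext => n; rewrite !fctE /GRing.scale /=; ring.
Qed.

(** A geometric series of ratio tanh r tanh s. It supplies the scalar that the annihilation
    equations leave open. *)
Lemma ip_sqvac (r s : R) : ip (sqvac r) (sqvac s) = (cosh (s - r))^-1.
Proof.
apply: ip_eq; try by [apply: rapid_l2; apply: rapid_sqvac].
pose q := tanh r * tanh s.
have q1 : `|q| < 1.
  rewrite normrM; apply: le_lt_trans (tanh_lt1 s).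
  by rewrite -[leRHS]mul1r ler_wpM2r // ltW // tanh_lt1.
have bE : bsum (fun n => sqvac r n * sqvac s n) = series (geometric (cosh r * cosh s)^-1 q).
  apply/funext => N; rewrite bsumE seriesEord; apply: eq_bigr => i _.
  rewrite (bigD1 i) //= big1 ?addr0; last first.
    by move=> j ji; rewrite /sqvac /= eq_sym val_eqE (negbTE ji) mul0r.
  by rewrite /sqvac /= eqxx /geometric /= /q (exprMn _ (tanh r) (tanh s)) (invfM (cosh r) (cosh s)); ring.
have -> : (cosh (s - r))^-1 = (cosh r * cosh s)^-1 / (1 - q).
  have cq : cosh r * cosh s * q = sinh r * sinh s.
    by rewrite -(cosh_tanh r) -(cosh_tanh s) /q; ring.
  rewrite coshD coshN sinhN -(invfM (cosh r * cosh s)); congr (_^-1).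
  by rewrite mulrBr mulr1 cq; ring.
by rewrite bE; exact: cvg_geometric_series.
Qed.

(** The image is annihilated by [A1 (r + s)] and [A2 (r + s)], hence a multiple of [sqvac (r + s)].
    Its coefficient at (0, 0) is an inner product of two squeezed vacua, which makes the multiple
    1. *)
Lemma rsqz_sqvac s r : rsqz s (sqvac r) = sqvac (r + s).
Proof.
have hO := rapid_sqvac r.
have rsqz0 : rsqz s 0 = 0 by apply/funext => m; rewrite /rsqz ipC ip0l.
have h1 : A1 (r + s) (rsqz s (sqvac r)) = 0 by rewrite -rsqz_A1 // A1_sqvac rsqz0.
have h2 : A2 (r + s) (rsqz s (sqvac r)) = 0 by rewrite -rsqz_A2 // A2_sqvac rsqz0.
rewrite (annihilated_sqvac h1 h2) /rsqz sqket00 ip_sqvac opprK.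
by rewrite mulfV ?cosh_neq0 // scale1r.
Qed.

Lemma rsqz_sqket s r m : rsqz s (sqket r m) = sqket (r + s) m.
Proof.
have V1 k x : rapid x -> rsqz s (iter k (A1d r) x) = iter k (A1d (r + s)) (rsqz s x) /\
    rapid (iter k (A1d r) x).
  move=> hx; elim: k => //= k [IH1 IH2]; rewrite rsqz_A1d // IH1.
  by split=> //; apply: rapid_A1d.
have V2 k x : rapid x -> rsqz s (iter k (A2d r) x) = iter k (A2d (r + s)) (rsqz s x) /\
    rapid (iter k (A2d r) x).
  move=> hx; elim: k => //= k [IH1 IH2]; rewrite rsqz_A2d // IH1.
  by split=> //; apply: rapid_A2d.
have [e2 r2] := V2 m.2 _ (rapid_sqvac r); have [e1 r1] := V1 m.1 _ r2.
by rewrite sqket.unlock rsqzZ ?e1 ?e2 ?rsqz_sqvac //; apply: rapid_l2.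
Qed.

(* The group law rsqz_sqket at (- r, r). *)
Lemma sqket_orthonormal (r : R) m n : ip (sqket r m) (sqket r n) = (m == n)%:R.
Proof.
have := rsqz_sqket (- r) r n; rewrite subrr sqket0 => /(congr1 (fun f => f m)).
by rewrite /rsqz opprK.
Qed.

Lemma rsqz_sum s J (r : seq J) (F : J -> rfock R) : (forall j, l2 (F j)) ->
  rsqz s (\sum_(j <- r) F j) = \sum_(j <- r) rsqz s (F j).
Proof.
move=> lF; apply/funext => m; rewrite /rsqz ipC ip_suml // fct_sumE.
by apply: eq_bigr => j _; rewrite ipC.
Qed.

Lemma sq_rsqz_le s x : l2 x -> l2 (rsqz s x) /\ sq (rsqz s x) <= sq x.
Proof.
move=> lx; have h := bessel (l2E (- s)) (sqket_orthonormal (- s)) lx.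
by split; [exists (sq x)|apply: sq_le].
Qed.

Lemma l2_rsqz s x : l2 x -> l2 (rsqz s x).
Proof. by move=> /(sq_rsqz_le s)[]. Qed.

Lemma trunc_sum N x : trunc N x = \sum_(n : 'I_N * 'I_N)
  x (val n.1, val n.2) *: rket R (val n.1, val n.2).
Proof.
apply/funext => -[i j]; rewrite fct_sumE /trunc /rket /=.
case: ifPn => [/andP[iN jN]|ij].
  rewrite (bigD1 (Ordinal iN, Ordinal jN)) //= big1 ?addr0.
    by rewrite fctE eqxx [RHS]mulr1.
  move=> [[k kN] [l lN]] /= ne; rewrite fctE; case: eqVneq => [[? ?]|_].
    by subst k l; case/eqP: ne; congr (_, _); apply: val_inj.
  exact: mulr0.
rewrite big1 // => -[[k kN] [l lN]] _ /=; rewrite fctE; case: eqVneq => [[? ?]|_].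
  by subst k l; rewrite kN lN in ij.
exact: mulr0.
Qed.

(** By linearity only number states matter: coefficient n of [rsqz s y] is the inner product of [y]
    with [sqket (- s) n], which is also the image of the number state under [rsqz (- s)]. *)
Lemma rsqz_adjoint_trunc s N x y : l2 y ->
  ip (trunc N x) (rsqz s y) = ip (rsqz (- s) (trunc N x)) y.
Proof.
move=> ly; have lk (n : 'I_N * 'I_N) : l2 (x (val n.1, val n.2) *: rket R (val n.1, val n.2)).
  by apply/l2Z/l2_rket.
have lVy := l2_rsqz s ly; have lVk n := l2_rsqz (- s) (lk n).
rewrite trunc_sum rsqz_sum // !ip_suml //.
apply: eq_bigr => n _; have {}lk := l2_rket R (val n.1, val n.2).
rewrite rsqzZ // !ipZl //; last exact: l2_rsqz.
rewrite ip_rketl //.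
by rewrite -sqket0 rsqz_sqket add0r.
Qed.

(** Density of truncations: the remainder tends to 0 in norm, [rsqz (- s)] is a contraction, and
    Cauchy-Schwarz bounds the pairing with [y]. *)
Lemma rsqz_adjoint s x y : l2 x -> l2 y -> ip x (rsqz s y) = ip (rsqz (- s) x) y.
Proof.
move=> lx ly; have lVy := l2_rsqz s ly.
have h1 := cvg_ip_trunc lx lVy.
suff h2 : (fun N => ip (trunc N x) (rsqz s y)) @ \oo --> ip (rsqz (- s) x) y.
  exact: (cvg_unique _ h1 h2).
have lt N := l2_trunc N x.
have lxt N : l2 (x - trunc N x) := l2B lx (lt N).
suff h : (fun N => ip (rsqz (- s) (x - trunc N x)) y) @ \oo --> (0 : R).
  have -> : (fun N => ip (trunc N x) (rsqz s y)) =
      (fun N => ip (rsqz (- s) x) y - ip (rsqz (- s) (x - trunc N x)) y).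
    apply/funext => N; rewrite rsqz_adjoint_trunc // rsqzB // ipBl //; try exact: l2_rsqz.
    by ring.
  by rewrite -[ip _ y]subr0; apply: cvgB => //; rewrite subr0; exact: cvg_cst.
apply: norm_cvg0.
have h3 N : `|ip (rsqz (- s) (x - trunc N x)) y| <= Num.sqrt (sq (x - trunc N x) * sq y).
  rewrite -sqrtr_sqr; apply: ler_wsqrtr; apply: le_trans (cauchy_schwarz _ ly) _.
    exact: l2_rsqz.
  by rewrite ler_wpM2r ?sq_ge0 //; case: (sq_rsqz_le (- s) (lxt N)).
apply: (@squeeze_cvgr _ _ _ _ (fun=> 0) (fun N => Num.sqrt (sq (x - trunc N x) * sq y))).
- by apply: nearW => N; rewrite normr_ge0 h3.
- exact: cvg_cst.
- rewrite -[X in _ --> X](sqrtr0 R); apply: continuous_cvg; first exact: sqrt_continuous.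
  by rewrite -(mul0r (sq y)); apply: cvgMl; exact: cvg_sub_trunc.
Qed.

(** The adjoint moves [rsqz s] onto the rows of [rsqz r], which are squeezed states, and on those
    the group law is known. *)
Lemma rsqz_group r s x : l2 x -> rsqz (r + s) x = rsqz r (rsqz s x).
Proof.
move=> lx; apply/funext => m; rewrite /rsqz -/(rsqz s x) rsqz_adjoint // rsqz_sqket.
by rewrite opprD.
Qed.

Lemma rsqz0 x : l2 x -> rsqz 0 x = x.
Proof. by move=> lx; apply/funext => m; rewrite /rsqz oppr0 sqket0 ip_rketl. Qed.

Lemma rsqzK s x : l2 x -> rsqz (- s) (rsqz s x) = x.
Proof. by move=> lx; rewrite -rsqz_group // addNr rsqz0. Qed.

(** A contraction whose inverse is a contraction is an isometry. *)
Lemma sq_rsqz s x : l2 x -> sq (rsqz s x) = sq x.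
Proof.
move=> lx; apply/eqP; rewrite eq_le (sq_rsqz_le s lx).2 /=.
by rewrite -{1}(rsqzK s lx); apply: (sq_rsqz_le (- s) (l2_rsqz s lx)).2.
Qed.

End Squeezing.

(** * Differential equations *)

Section RealDerivatives.
Variable R : realType.
Implicit Types (f g : R -> R) (x : R).

Lemma is_derive_fM f g x (df dg : R) : is_derive x 1 f df -> is_derive x 1 g dg ->
  is_derive x 1 (fun t => f t * g t) (df * g x + f x * dg).
Proof.
move=> hf hg; apply: is_derive_eq.
by rewrite /GRing.scale /= addrC; congr (_ + _); rewrite mulrC.
Qed.

Lemma is_derive_fB f g x (df dg : R) : is_derive x 1 f df -> is_derive x 1 g dg ->
  is_derive x 1 (fun t => f t - g t) (df - dg).
Proof. by move=> hf hg; apply: is_deriveB. Qed.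

Lemma is_derive_fD f g x (df dg : R) : is_derive x 1 f df -> is_derive x 1 g dg ->
  is_derive x 1 (fun t => f t + g t) (df + dg).
Proof. by move=> hf hg; apply: is_deriveD. Qed.

Lemma is_derive_cM a f x (df : R) : is_derive x 1 f df ->
  is_derive x 1 (fun t => a * f t) (a * df).
Proof. by move=> hf; apply: is_deriveZ. Qed.

Lemma is_derive_fX f x (df : R) k : is_derive x 1 f df ->
  is_derive x 1 (fun t => f t ^+ k) (k%:R * f x ^+ k.-1 * df).
Proof. by move=> hf; have := is_deriveX k hf; rewrite exprfctE. Qed.

Lemma is_derive_fV f x (df : R) : f x != 0 -> is_derive x 1 f df ->
  is_derive x 1 (fun t => (f t)^-1) (- df / f x ^+ 2).
Proof.
move=> f0 [hf <-]; apply: DeriveDef; first exact: derivableV.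
by rewrite deriveV // /GRing.scale /= mulrC mulrN mulNr.
Qed.

Lemma is_derive_translate f (df : R -> R) a : (forall x, is_derive x 1 f (df x)) ->
  forall x, is_derive x 1 (fun t => f (a + t)) (df (a + x)).
Proof.
move=> h x.
have hs : is_derive x 1 (fun t : R => a + t) 1.
  rewrite -[X in is_derive _ _ _ X](add0r 1).
  exact: (is_deriveD (is_derive_cst a x 1) (is_derive_id x 1)).
have := @is_derive1_comp R f (fun t => a + t) x _ _ (h _) hs; rewrite mulr1 => hc; exact: hc.
Qed.

Lemma is_derive_reflect f (df : R -> R) : (forall x, is_derive x 1 f (df x)) ->
  forall x, is_derive x 1 (fun t => f (- t)) (- df (- x)).
Proof.
move=> h x.
have hs : is_derive x 1 (fun t : R => - t) (- 1) by exact: is_deriveNid.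
have := @is_derive1_comp R f (fun t => - t) x _ _ (h _) hs; rewrite mulrN1 => hc; exact: hc.
Qed.

Lemma is_derive_continuous f (df : R) x : is_derive x 1 f df -> {for x, continuous f}.
Proof.
by move=> [h _]; apply: differentiable_continuous; apply/derivable1_diffP.
Qed.

Lemma mean_value f (df : R -> R) a b : a < b -> (forall x, is_derive x 1 f (df x)) ->
  exists2 c, a < c < b & f b - f a = df c * (b - a).
Proof.
move=> ab h; have [|c cab e] := @MVT R f df a b ab (fun x _ => h x).
- by apply: continuous_subspaceT => x; exact: is_derive_continuous (h x).
- by exists c => //; rewrite in_itv in cab.
Qed.

(** One step of a Taylor estimate without integrals: the mean value theorem is applied to
    [K * t ^+ k.+1 - g], then to [- g] in place of [g], and negative [s] is reached by
    reflection. *)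
Lemma le_powerS_of_derive f (df : R -> R) (K s : R) k : (forall x, is_derive x 1 f (df x)) ->
    f 0 = 0 -> (forall t, `|t| <= `|s| -> `|df t| <= K * k.+1%:R * `|t| ^+ k) ->
  `|f s| <= K * `|s| ^+ k.+1.
Proof.
have half g dg t : (forall x, is_derive x 1 g (dg x)) -> g 0 = 0 -> 0 < t ->
    (forall u, 0 < u < t -> dg u <= K * k.+1%:R * u ^+ k) -> g t <= K * t ^+ k.+1.
  move=> hg g0 t0 hdg.
  have hX x : is_derive x 1 (fun u : R => K * u ^+ k.+1) (K * (k.+1%:R * x ^+ k)).
    by apply: is_derive_cM; rewrite -[_ * x ^+ k]mulr1; apply: is_derive_fX.
  have [c /andP[c0 ct]] := mean_value t0 (fun x => is_derive_fB (hX x) (hg x)).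
  rewrite /= g0 expr0n /= mulr0 !subr0 => e; rewrite -subr_ge0 e.
  by rewrite mulr_ge0 ?(ltW t0) // subr_ge0 mulrA hdg // c0 ct.
have both g dg t : (forall x, is_derive x 1 g (dg x)) -> g 0 = 0 -> 0 < t ->
    (forall u, 0 < u < t -> `|dg u| <= K * k.+1%:R * u ^+ k) -> `|g t| <= K * t ^+ k.+1.
  move=> hg g0 t0 hdg; rewrite ler_norml lerNl; apply/andP; split; last first.
    by apply: (half _ _ _ hg) => // u hu; apply: le_trans (hdg u hu); exact: ler_norm.
  have hN x : is_derive x 1 (fun t => - g t) (- dg x) by apply: is_deriveN.
  apply: (half _ _ _ hN) => //; first by rewrite g0 oppr0.
  by move=> u hu; apply: le_trans (hdg u hu); rewrite -normrN; exact: ler_norm.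
move=> hf f0 hdf; have [s0|s0|s0] := ltgtP s 0.
- have := both _ _ (- s) (is_derive_reflect hf); rewrite oppr0 f0 opprK oppr_gt0.
  rewrite (ltr0_norm s0); apply=> // u /andP[u0 us]; rewrite normrN.
  have := hdf (- u); rewrite normrN (gtr0_norm u0); apply.
  by rewrite (ltr0_norm s0) ltW.
- rewrite (gtr0_norm s0); apply: both => // u /andP[u0 us].
  have := hdf u; rewrite (gtr0_norm u0); apply.
  by rewrite (gtr0_norm s0) ltW.
- by rewrite s0 f0 normr0 expr0n /= mulr0.
Qed.

(** Near 0 the derivative is at most [2 e |h|], so the previous estimate with exponent 1 bounds [f]
    by [e h^2]. *)
Lemma derive_littleo_sqr f (k : R -> R) : (forall h : R, is_derive h 1 f (2 * h * k h)) -> f 0 = 0 ->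
  {for 0, continuous k} -> k 0 = 0 ->
  (fun h => h ^- 2 * f h) @ (0 : R)^' --> (0 : R).
Proof.
move=> hf f0 ck k0; apply/cvgrPdist_le => e e0.
have /cvgrPdist_lt /(_ e e0) := ck; rewrite k0 => /nbhs_ballP[d /= d0 hd].
have hd' t : `|t| < d -> `|k t| <= e.
  by move=> td; have := hd t; rewrite /ball /= !sub0r !normrN => /(_ td)/ltW.
near=> h; rewrite sub0r normrN normrM normfV normrX.
have h0 : h != 0 by near: h; exact: nbhs_dnbhs_neq.
have hd2 : `|h| < d.
  near: h; apply: dnbhs0_lt => //.
have hh : 0 < `|h| ^+ 2 by rewrite exprn_gt0 // normr_gt0.
rewrite mulrC ler_pdivrMr //; apply: (le_powerS_of_derive hf f0) => t th.
rewrite !normrM expr1 (ger0_norm (_ : 0 <= 2)) // [leRHS]mulrAC.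
rewrite mulrC (mulrC 2) mulrA mulrAC [leRHS]mulrAC; apply: ler_wpM2r => //.
by apply: ler_wpM2r => //; apply: hd'; exact: le_lt_trans th hd2.
Unshelve. all: end_near. Qed.

End RealDerivatives.

(** * The strong derivative of the squeezing matrix at 0 *)

Section SqueezingDerivative.
Variable R : realType.
Implicit Types x y : rfock R.

Definition rgen x : rfock R := rb1d (rb2d x) - rb1 (rb2 x).

Lemma rgenE x n : rgen x n = Num.sqrt n.1%:R * (Num.sqrt n.2%:R * x (n.1.-1, n.2.-1)) -
  Num.sqrt n.1.+1%:R * (Num.sqrt n.2.+1%:R * x (n.1.+1, n.2.+1)).
Proof. by []. Qed.

Lemma rapid_rgen x : rapid x -> rapid (rgen x).
Proof.
by move=> hx; apply: rapidB; [apply/rapid_rb1d/rapid_rb2d|apply/rapid_rb1/rapid_rb2].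
Qed.

Lemma rgen_skew x y : rapid x -> rapid y -> ip (rgen x) y = - ip x (rgen y).
Proof.
move=> hx hy.
have [h1 h2] := (rapid_rb1 hx, rapid_rb1d hx).
have [h3 h4] := (rapid_rb2 hx, rapid_rb2d hx).
have [k1 k2] := (rapid_rb1 hy, rapid_rb1d hy).
have [k3 k4] := (rapid_rb2 hy, rapid_rb2d hy).
have e1 : ip (rb1d (rb2d x)) y = ip x (rb1 (rb2 y)).
  by rewrite (adjoint_rb1 h4 hy) (adjoint_rb2 hx k1) rb2_rb1.
have e2 : ip (rb1 (rb2 x)) y = ip x (rb1d (rb2d y)).
  by rewrite ipC -(adjoint_rb1 hy h3) -(adjoint_rb2 k2 hx) rb2d_rb1d ipC.
have [lx ly] := (rapid_l2 hx, rapid_l2 hy).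
have [l1 l2'] := (rapid_l2 (rapid_rb1d h4), rapid_l2 (rapid_rb1 h3)).
have [l3 l4] := (rapid_l2 (rapid_rb1d k4), rapid_l2 (rapid_rb1 k3)).
by rewrite /rgen ipBl // ipBr // e1 e2 opprB.
Qed.

(* The formal Heisenberg equation for U(r) a1^dagger U(r)^-1, and its analogue for a2. *)
Lemma rgen_A1d r x : rgen (A1d r x) = A1d r (rgen x) + (sinh r *: rb1d x - cosh r *: rb2 x).
Proof.
rewrite /rgen /A1d ?rladder_lin ?rccr ?rladder_lin ?rccr.
by apply/funext => n; rewrite !fctE /GRing.scale /=; ring.
Qed.

Lemma rgen_A2d r x : rgen (A2d r x) = A2d r (rgen x) + (sinh r *: rb2d x - cosh r *: rb1 x).
Proof.
rewrite /rgen /A2d ?rladder_lin ?rccr ?rladder_lin ?rccr.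
by apply/funext => n; rewrite !fctE /GRing.scale /=; ring.
Qed.

(** The equation x' = G x holds coefficient by coefficient: [rgen] reads two coefficients of its
    argument, so each line is a scalar derivative. *)
Definition solves (F : R -> rfock R) :=
  forall (r : R) n, is_derive r 1 (fun t => F t n) (rgen (F r) n).

(** Since tanh' = 1 - tanh^2, the derivative of tanh^i / cosh is (i tanh^(i-1) - (i+1) tanh^(i+1)) /
    cosh, and i and i + 1 are the products of ladder factors on the diagonal. *)
Lemma solves_sqvac : solves (@sqvac R).
Proof.
move=> r [i j]; rewrite rgenE /sqvac /=.
have [<-|ij] := eqVneq i j; last first.
  rewrite eqSS (negbTE ij).
  have -> : Num.sqrt i%:R * (Num.sqrt j%:R *
      (if i.-1 == j.-1 then tanh r ^+ i.-1 / cosh r else 0)) = 0.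
    case: i j ij => [|i] [|j] //=; rewrite ?sqrtr0 ?mul0r ?mulr0 //.
    by rewrite eqSS => /negbTE ->; rewrite !mulr0.
  by rewrite !mulr0 subr0; exact: is_derive_cst.
rewrite !eqxx !mulrA !sqrt_natK.
have hc := is_derive_cosh r; have hs := is_derive_sinh r.
have hV := is_derive_fV (cosh_neq0 r) hc.
have ht := is_derive_fX i (is_derive_fM hs hV).
apply: is_derive_eq (is_derive_fM ht hV) _.
have c0 := cosh_neq0 r; rewrite -natr1 -/(tanh r).
have -> : cosh r / cosh r + sinh r * (- sinh r / cosh r ^+ 2) = 1 - tanh r ^+ 2.
  by rewrite /tanh; field.
have -> : tanh r ^+ i * (- sinh r / cosh r ^+ 2) = - tanh r ^+ i.+1 / cosh r.
  by rewrite (exprS _ i) -(cosh_tanh r); move: (tanh r) => t; field.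
move: (tanh r) => t; case: i {ht} => [|i] /=; first by field.
by rewrite -natr1 !exprS; field.
Qed.

Lemma solves_Z a F : solves F -> solves (fun r => a *: F r).
Proof.
move=> hF r n; have -> : rgen (a *: F r) n = a * rgen (F r) n.
  by rewrite !rgenE !fctE /GRing.scale /=; ring.
by apply: is_derive_cM.
Qed.

(** The derivative of the coefficients of [A1d r] is the commutator term of [rgen_A1d], so [A1d r]
    carries solutions to solutions. *)
Lemma solves_A1d F : solves F -> solves (fun r => A1d r (F r)).
Proof.
move=> hF r n; rewrite rgen_A1d.
have hc := is_derive_cosh r; have hs := is_derive_sinh r.
apply: is_derive_eq (is_derive_fB
  (is_derive_fM hc (is_derive_cM (Num.sqrt n.1%:R) (hF r (n.1.-1, n.2))))
  (is_derive_fM hs (is_derive_cM (Num.sqrt n.2.+1%:R) (hF r (n.1, n.2.+1))))) _.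
by rewrite /A1d /rb1d /rb2 !fctE /GRing.scale /=; ring.
Qed.

Lemma solves_A2d F : solves F -> solves (fun r => A2d r (F r)).
Proof.
move=> hF r n; rewrite rgen_A2d.
have hc := is_derive_cosh r; have hs := is_derive_sinh r.
apply: is_derive_eq (is_derive_fB
  (is_derive_fM hc (is_derive_cM (Num.sqrt n.2%:R) (hF r (n.1, n.2.-1))))
  (is_derive_fM hs (is_derive_cM (Num.sqrt n.1.+1%:R) (hF r (n.1.+1, n.2))))) _.
by rewrite /A2d /rb2d /rb1 !fctE /GRing.scale /=; ring.
Qed.

Lemma solves_sqket m : solves (fun r => sqket r m).
Proof.
rewrite sqket.unlock; apply: solves_Z.
elim: m.1 => [|k IH] /=; last exact: solves_A1d.
elim: m.2 => [|k IH] /=; last exact: solves_A2d.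
exact: solves_sqvac.
Qed.

Lemma solves_rgen F : solves F -> solves (fun r => rgen (F r)).
Proof.
move=> hF r n.
exact: (is_derive_fB
  (is_derive_cM (Num.sqrt n.1%:R) (is_derive_cM (Num.sqrt n.2%:R) (hF r (n.1.-1, n.2.-1))))
  (is_derive_cM (Num.sqrt n.1.+1%:R) (is_derive_cM (Num.sqrt n.2.+1%:R) (hF r (n.1.+1, n.2.+1))))).
Qed.

Lemma rapid_rket m : rapid (rket R m).
Proof. by rewrite -sqket0; exact: rapid_sqket. Qed.

(* With g h = <rgen e, rsqz h e>, the squared norm f h satisfies f 0 = 0 and
   f' h = 2 h (|rgen e|^2 - g' h), because the diagonal element has derivative - g. *)
Lemma rsqz_derivative m :
  (fun h => h ^- 2 * sq (rsqz h (rket R m) - rket R m - h *: rgen (rket R m))) @ (0 : R)^' -->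
  (0 : R).
Proof.
set e := rket R m; have re : rapid e by exact: rapid_rket.
have rG := rapid_rgen re; have le := rapid_l2 re; have lG := rapid_l2 rG.
set c := sq (rgen e).
have eGe : ip e (rgen e) = 0 by have := rgen_skew re re; rewrite ipC; lra.
have VE h : rsqz h e = sqket h m by rewrite /e -sqket0 rsqz_sqket add0r.
have gE h : ip (rgen e) (sqket h m) = - rgen (sqket h m) m.
  have rE := rapid_sqket h m.
  by rewrite rgen_skew // ip_rketl //; apply/rapid_l2/rapid_rgen.
(* As [rsqz h] is an isometry and [e] is orthogonal to [rgen e], the matrix enters only through one
   coefficient of [sqket h m] and one of its image under [rgen]. *)
have fE h : sq (rsqz h e - e - h *: rgen e) =
    2 + h ^+ 2 * c - 2 * sqket h m m + 2 * (h * rgen (sqket h m) m).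
  have lV := l2_rsqz h le.
  have lhG := l2Z h lG; have lB := l2B lV le.
  rewrite sqB // (sqB lV le) sqZ // ipBl // !ipZr // sq_rsqz //.
  rewrite sq_rket eGe VE (ipC _ (rgen e)) gE ip_rketr; last by apply/rapid_l2/rapid_sqket.
  by rewrite -/c; ring.
have d1 h := solves_sqket m h m.
have d2 h := solves_rgen (solves_sqket m) h m.
have d3 h := solves_rgen (solves_rgen (solves_sqket m)) h m.
under eq_fun do rewrite fE.
apply: (@derive_littleo_sqr _ _ (fun h => c + rgen (rgen (sqket h m)) m)).
- move=> h; have hid := is_derive_id h (1 : R).
  have hX := is_derive_fX 2 hid.
  have hcst := is_derive_cst (2 : R) h (1 : R).
  apply: is_derive_eq (is_derive_fD (is_derive_fB (is_derive_fD hcst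
     (is_derive_fM hX (is_derive_cst c h 1))) (is_derive_cM 2 (d1 h)))
     (is_derive_cM 2 (is_derive_fM hid (d2 h)))) _.
  by rewrite /=; ring.
- by rewrite sqket0 /rket eqxx expr0n /=; ring.
- apply: continuousD; first exact: cst_continuous.
  exact: is_derive_continuous (d3 0).
(* By skew symmetry the diagonal element of the squared generator is minus the squared norm of
   [rgen e], which cancels [c]. *)
- rewrite sqket0 -[rgen _ m]ip_rketl; last by apply/rapid_l2/rapid_rgen.
  by rewrite -/e ipC rgen_skew // -/c subrr.
Qed.

End SqueezingDerivative.

(** * Uniqueness of bounded solutions *)

Section Uniqueness.
Variable R : realType.

Lemma bin_le_exp2 n k : ('C(n, k) <= 2 ^ n)%N.
Proof.
elim: n k => [|n IH] [|k] //; first by rewrite bin0 expn_gt0.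
by rewrite binS expnS mul2n -addnn leq_add.
Qed.

Lemma sqrtM_nat_le (a b p : nat) : (a <= p)%N -> (b <= p)%N ->
  Num.sqrt a%:R * Num.sqrt b%:R <= p%:R :> R.
Proof.
move=> ap bp; rewrite -sqrt_natK; apply: ler_pM; rewrite ?sqrtr_ge0 //;
by apply: ler_wsqrtr; rewrite ler_nat.
Qed.

(* The k-th Taylor bound at distance max n.1 n.2 from the vacuum; its radius of
   convergence does not depend on n, so a bounded solution vanishing at one time
   vanishes in a neighbourhood of fixed size. *)
Lemma bounded_solution_taylor (z : R -> rfock R) (C : R) :
    (forall (s : R) n, is_derive s 1 (fun t => z t n) (- rgen (z s) n)) ->
    (forall s n, `|z s n| <= C) -> (forall n, z 0 n = 0) ->
  forall k s n, `|z s n| <=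
    C * 2 ^+ k * 'C(maxn n.1 n.2 + k, k)%:R * `|s| ^+ k.
Proof.
move=> hz zC z0; have C0 : 0 <= C := le_trans (normr_ge0 _) (zC 0 (0, 0)%N).
elim=> [|k IH] s [i j]; first by rewrite bin0 !expr0 !mulr1.
set p := maxn i j; rewrite /= -/p.
apply: (le_powerS_of_derive (fun x => hz x (i, j))) => // t ts.
rewrite normrN rgenE /=; set B : R := C * 2 ^+ k * 'C(p.+1 + k, k)%:R * `|t| ^+ k.
have step i' j' : (maxn i' j' <= p.+1)%N -> `|z t (i', j')| <= B.
  move=> h; apply: le_trans (IH t (i', j')) _.
  rewrite ler_wpM2r ?exprn_ge0 // ler_wpM2l ?mulr_ge0 ?exprn_ge0 //.
  by rewrite ler_nat leq_bin2l // leq_add2r.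
(* Absorption: the factor k + 1 from the derivative of the power trades the binomial at p for p + 1
   times the one at p + 1. Here p + 1 bounds the ladder factors, and the two terms of [rgen] give
   the new factor 2. *)
have bE : 'C(p + k.+1, k.+1)%:R * k.+1%:R = p.+1%:R * 'C(p.+1 + k, k)%:R :> R.
  have := mul_bin_left (p.+1 + k) k; rewrite addnK => e.
  by rewrite -!natrM -e addnS mulnC.
have -> : C * 2 ^+ k.+1 * 'C(p + k.+1, k.+1)%:R * k.+1%:R * `|t| ^+ k =
    p.+1%:R * B + p.+1%:R * B.
  by rewrite -[_ * k.+1%:R]mulrA bE /B exprS; ring.
have hp : (i <= p)%N /\ (j <= p)%N by rewrite leq_maxl leq_maxr.
have bnd a b i' j' : (a <= p.+1)%N -> (b <= p.+1)%N -> (maxn i' j' <= p.+1)%N ->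
    `|Num.sqrt a%:R * (Num.sqrt b%:R * z t (i', j'))| <= p.+1%:R * B.
  move=> ap bp h; rewrite mulrA normrM ger0_norm ?mulr_ge0 ?sqrtr_ge0 //.
  by rewrite ler_pM ?mulr_ge0 ?sqrtr_ge0 ?sqrtM_nat_le // step.
by apply: le_trans (ler_normB _ _) _; apply: lerD; apply: bnd; lia.
Qed.

(** The radius is 2^-3 because the Taylor bound grows by a factor 2 per step, the binomial
    coefficient by at most another 2, and the third makes the bound [C 2^p 2^-k], which tends to
    0. *)
Lemma bounded_solution_local (z : R -> rfock R) (C : R) :
    (forall (s : R) n, is_derive s 1 (fun t => z t n) (- rgen (z s) n)) ->
    (forall s n, `|z s n| <= C) -> (forall n, z 0 n = 0) ->
  forall s n, `|s| <= 8^-1 -> z s n = 0.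
Proof.
move=> hz zC z0 s n s8; apply/eqP; rewrite -normr_le0.
have C0 : 0 <= C := le_trans (normr_ge0 _) (zC 0 (0, 0)%N).
pose p := maxn n.1 n.2.
have h k : `|z s n| <= C * 2 ^+ p * (2^-1) ^+ k.
  apply: le_trans (bounded_solution_taylor hz zC z0 k s n) _; rewrite -/p.
  apply: (@le_trans _ _ (C * 2 ^+ k * 2 ^+ (p + k) * 8^-1 ^+ k)).
    apply: ler_pM; rewrite ?mulr_ge0 ?exprn_ge0 ?lerXn2r ?nnegrE //.
    by rewrite ler_wpM2l ?mulr_ge0 ?exprn_ge0 // -natrX ler_nat bin_le_exp2.
  rewrite exprD le_eqVlt; apply/orP; left; apply/eqP.
  have -> : (2^-1 : R) ^+ k = 2 ^+ k * 2 ^+ k * 8^-1 ^+ k.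
    by rewrite -!exprMn; congr (_ ^+ _); field.
  by ring.
have cv : (fun k => C * 2 ^+ p * (2^-1) ^+ k) @ \oo --> (0 : R).
  apply: cvg_geometric; rewrite ger0_norm //; lra.
rewrite -(cvg_lim (@Rhausdorff R) cv); apply: limr_ge; first exact: cvgP cv.
by apply: nearW => k; exact: h.
Qed.

(** The system is autonomous and [C] does not depend on time, so the local statement restarts at
    each multiple of a step [d] of length at most 1/8. *)
Lemma bounded_solution_eq0 (z : R -> rfock R) (C : R) :
    (forall (s : R) n, is_derive s 1 (fun t => z t n) (- rgen (z s) n)) ->
    (forall s n, `|z s n| <= C) -> (forall n, z 0 n = 0) ->
  forall s n, z s n = 0.
Proof.
move=> hz zC z0 s n.
have [N hN] : exists N : nat, `|s| * 8 < N.+1%:R.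
  exists (Num.truncn (`|s| * 8)); exact: truncnS_gt.
pose d := s / N.+1%:R.
have d8 : `|d| <= 8^-1.
  rewrite normrM normfV (ger0_norm (_ : 0 <= N.+1%:R)) // ler_pdivrMr //.
  by rewrite mulrC ler_pdivlMr // ltW.
have step i : forall n, z (i%:R * d) n = 0.
  elim: i => [|i IH] k; first by rewrite mul0r.
  have := @bounded_solution_local (fun t => z (i%:R * d + t)) C _ _ _ d k d8.
  rewrite -natr1 mulrDl mul1r; apply.
  - move=> u l; exact: (@is_derive_translate _ (fun t => z t l) (fun t => - rgen (z t) l) _ (fun x => hz x l) u).
  - by move=> u l; exact: zC.
  - by move=> l; rewrite addr0.
by have := step N.+1 n; rewrite /d mulrC divfK // pnatr_eq0.
Qed.

End Uniqueness.

(** * Complex families *)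

Section ComplexFamilies.
Variable R : realType.
Implicit Types (psi phi : fock R) (x y : rfock R).

Definition reF psi : rfock R := fun n => complex.Re (psi n).
Definition imF psi : rfock R := fun n => complex.Im (psi n).
Definition cx x y : fock R := fun n => Complex (x n) (y n).

Lemma fock_eq psi phi : reF psi = reF phi -> imF psi = imF phi -> psi = phi.
Proof.
move=> hr hi; apply/funext => n; apply/eqP; rewrite eq_complex.
by apply/andP; split; apply/eqP; [exact: (congr1 (fun f => f n) hr)|exact: (congr1 (fun f => f n) hi)].
Qed.

Lemma reFD psi phi : reF (psi + phi) = reF psi + reF phi.
Proof. by apply/funext => n; rewrite /reF !fctE; case: (psi n); case: (phi n). Qed.
Lemma imFD psi phi : imF (psi + phi) = imF psi + imF phi.
Proof. by apply/funext => n; rewrite /imF !fctE; case: (psi n); case: (phi n). Qed.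
Lemma reFN psi : reF (- psi) = - reF psi.
Proof. by apply/funext => n; rewrite /reF !fctE; case: (psi n). Qed.
Lemma imFN psi : imF (- psi) = - imF psi.
Proof. by apply/funext => n; rewrite /imF !fctE; case: (psi n). Qed.
Lemma ReM (c z : R[i]) : complex.Re (c * z) =
  complex.Re c * complex.Re z - complex.Im c * complex.Im z.
Proof. by case: c; case: z. Qed.
Lemma ImM (c z : R[i]) : complex.Im (c * z) =
  complex.Re c * complex.Im z + complex.Im c * complex.Re z.
Proof. by case: c; case: z. Qed.
Lemma reFZ c psi : reF (c *: psi) = complex.Re c *: reF psi - complex.Im c *: imF psi.
Proof. by apply/funext => n; exact: ReM. Qed.
Lemma imFZ c psi : imF (c *: psi) = complex.Re c *: imF psi + complex.Im c *: reF psi.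
Proof. by apply/funext => n; exact: ImM. Qed.
Lemma reFZr (a : R) psi : reF (a%:C *: psi) = a *: reF psi.
Proof. by rewrite reFZ /= scale0r subr0. Qed.
Lemma imFZr (a : R) psi : imF (a%:C *: psi) = a *: imF psi.
Proof. by rewrite imFZ /= scale0r addr0. Qed.
Lemma reFB psi phi : reF (psi - phi) = reF psi - reF phi.
Proof. by rewrite reFD reFN. Qed.
Lemma imFB psi phi : imF (psi - phi) = imF psi - imF phi.
Proof. by rewrite imFD imFN. Qed.

Lemma reF_ket i j : reF (ket R i j) = rket R (i, j).
Proof. by apply/funext => n; rewrite /reF /ket /rket; case: eqP. Qed.
Lemma imF_ket i j : imF (ket R i j) = 0.
Proof. by apply/funext => n; rewrite /imF /ket; case: eqP. Qed.

Lemma reF_real (a : R) (z : R[i]) : complex.Re (a%:C * z) = a * complex.Re z.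
Proof. by rewrite ReM /= mul0r subr0. Qed.
Lemma imF_real (a : R) (z : R[i]) : complex.Im (a%:C * z) = a * complex.Im z.
Proof. by rewrite ImM /= mul0r addr0. Qed.

Lemma reF_a1 psi : reF (a1 psi) = rb1 (reF psi).
Proof. by apply/funext => n; rewrite /reF reF_real. Qed.
Lemma imF_a1 psi : imF (a1 psi) = rb1 (imF psi).
Proof. by apply/funext => n; rewrite /imF imF_real. Qed.
Lemma reF_a2 psi : reF (a2 psi) = rb2 (reF psi).
Proof. by apply/funext => n; rewrite /reF reF_real. Qed.
Lemma imF_a2 psi : imF (a2 psi) = rb2 (imF psi).
Proof. by apply/funext => n; rewrite /imF imF_real. Qed.
Lemma reF_a1d psi : reF (a1d psi) = rb1d (reF psi).
Proof. by apply/funext => n; rewrite /reF reF_real. Qed.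
Lemma imF_a1d psi : imF (a1d psi) = rb1d (imF psi).
Proof. by apply/funext => n; rewrite /imF imF_real. Qed.
Lemma reF_a2d psi : reF (a2d psi) = rb2d (reF psi).
Proof. by apply/funext => n; rewrite /reF reF_real. Qed.
Lemma imF_a2d psi : imF (a2d psi) = rb2d (imF psi).
Proof. by apply/funext => n; rewrite /imF imF_real. Qed.

Definition reF_ladder := (reF_a1, reF_a2, reF_a1d, reF_a2d).
Definition imF_ladder := (imF_a1, imF_a2, imF_a1d, imF_a2d).

Lemma reF_rgen psi : reF (squeezing_generator psi) = rgen (reF psi).
Proof. by rewrite /squeezing_generator !fctE /= reFB !reF_ladder. Qed.
Lemma imF_rgen psi : imF (squeezing_generator psi) = rgen (imF psi).
Proof. by rewrite /squeezing_generator !fctE /= imFB !imF_ladder. Qed.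

Definition cl2 psi := l2 (reF psi) /\ l2 (imF psi).

(* The real part of the Hermitian product: it determines it, and is real bilinear. *)
Definition cip psi phi : R := ip (reF psi) (reF phi) + ip (imF psi) (imF phi).

Definition csq psi : R := cip psi psi.

(** The box as a duplicate-free sequence, the form in which it meets the finite sets behind
    [norm2]. *)
Definition boxseq N : seq (nat * nat) :=
  [seq (val n.1, val n.2) | n <- enum [set: 'I_N * 'I_N]%SET].

Lemma boxseq_uniq N : uniq (boxseq N).
Proof.
rewrite map_inj_uniq ?enum_uniq // => -[i j] [i' j'] [/val_inj-> /val_inj->] //.
Qed.

Lemma mem_boxseq N n : (n.1 < N)%N -> (n.2 < N)%N -> n \in boxseq N.
Proof.
move=> n1 n2; apply/mapP; exists (Ordinal n1, Ordinal n2); last by case: n n1 n2.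
by rewrite mem_enum inE.
Qed.

Lemma bsum_boxseq (f : nat * nat -> R) N : bsum f N = \sum_(n <- boxseq N) f n.
Proof.
rewrite /boxseq big_map big_enum /bsum /=; apply: eq_bigl => n; by rewrite inE.
Qed.

Let q psi (n : nat * nat) : R := complex.Re (psi n) ^+ 2 + complex.Im (psi n) ^+ 2.

Let q_ge0 psi n : 0 <= q psi n.
Proof. by rewrite addr_ge0 ?sqr_ge0. Qed.

Let bsum_q psi N : bsum (q psi) N =
  bsum (fun n => reF psi n ^+ 2) N + bsum (fun n => imF psi n ^+ 2) N.
Proof. exact: bsumD. Qed.

Lemma bsum_le_norm2 psi N : ((bsum (q psi) N)%:E <= norm2 psi)%E.
Proof.
apply: esum_ge; exists [set` boxseq N]; first by split; [exact: finite_seq|].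
by rewrite -fsbig_seq ?boxseq_uniq // bsum_boxseq -sumEFin.
Qed.

(** Every finite set of indices lies in a box, so box sums dominate the supremum over finite
    sets. *)
Lemma norm2_le psi C : (forall N, bsum (q psi) N <= C) -> (norm2 psi <= C%:E)%E.
Proof.
move=> hC; apply: ge_ereal_sup => _ [X [finX _] <-].
have [N hN] : exists N, forall n, X n -> ((n.1 < N) && (n.2 < N))%N.
  have /finite_seqP[r ->] := finX.
  exists (\max_(n <- r) (maxn n.1 n.2)).+1 => n /= nr.
  have : (maxn n.1 n.2 <= \max_(n <- r) (maxn n.1 n.2))%N.
    exact: (@leq_bigmax_seq _ r xpredT (fun n => maxn n.1 n.2) n nr isT).
  by rewrite geq_max !ltnS.
apply: le_trans (_ : ((bsum (q psi) N)%:E <= _)%E); last by rewrite lee_fin.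
rewrite bsum_boxseq -sumEFin [leRHS]fsbig_seq ?boxseq_uniq //=.
apply: lee_fsum_nneg_subset => //; first exact: finite_seq.
- by move=> n /[!inE] /hN /andP[n1 n2]; apply: mem_boxseq.
- by move=> n _; rewrite lee_fin q_ge0.
Qed.

Lemma norm2_ge0 psi : (0 <= norm2 psi)%E.
Proof. by apply: esum_ge0 => n _; rewrite lee_fin q_ge0. Qed.

Lemma norm2E psi : cl2 psi -> norm2 psi = (csq psi)%:E.
Proof.
move=> [lr li]; apply/eqP; rewrite eq_le; apply/andP; split.
  apply: norm2_le => N; rewrite bsum_q; apply: lerD; exact: bsum_le_sq.
have nfin : norm2 psi \is a fin_num.
  apply/fin_real/andP; split; first by apply: lt_le_trans (norm2_ge0 psi).
  apply: le_lt_trans (_ : (norm2 psi <= (csq psi)%:E)%E) (ltry _).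
  apply: norm2_le => N; rewrite bsum_q; apply: lerD; exact: bsum_le_sq.
rewrite -(fineK nfin) lee_fin.
have cv : (fun N => bsum (fun n => reF psi n * reF psi n) N +
    bsum (fun n => imF psi n * imF psi n) N) @ \oo --> csq psi.
  by apply: cvgD; [exact: cvg_sq lr|exact: cvg_sq li].
rewrite -(cvg_lim (@Rhausdorff R) cv); apply: limr_le; first exact: cvgP cv.
apply: nearW => N; rewrite -lee_fin (fineK nfin); apply: le_trans (bsum_le_norm2 psi N).
by rewrite lee_fin bsum_q; apply: lerD; apply: ler_bsum => n; rewrite expr2.
Qed.

Lemma ell2P psi : ell2 psi <-> cl2 psi.
Proof.
split=> [h|h]; last by rewrite /ell2 /= norm2E // ltry.
have nfin : norm2 psi \is a fin_num.
  by apply/fin_real/andP; split=> //; apply: lt_le_trans (norm2_ge0 psi).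
have hN N : bsum (q psi) N <= fine (norm2 psi).
  by rewrite -lee_fin fineK // bsum_le_norm2.
split; exists (fine (norm2 psi)) => N; apply: le_trans (hN N); apply: ler_bsum => n.
  by rewrite /q lerDl sqr_ge0.
by rewrite /q lerDr sqr_ge0.
Qed.

Lemma cl2D psi phi : cl2 psi -> cl2 phi -> cl2 (psi + phi).
Proof. by move=> [? ?] [? ?]; split; rewrite ?reFD ?imFD; apply: l2D. Qed.
Lemma cl2Z c psi : cl2 psi -> cl2 (c *: psi).
Proof.
by move=> [? ?]; split; rewrite ?reFZ ?imFZ; [apply: l2B|apply: l2D]; apply: l2Z.
Qed.
Lemma cl2N psi : cl2 psi -> cl2 (- psi).
Proof. by move=> ?; rewrite -scaleN1r; apply: cl2Z. Qed.
Lemma cl2B psi phi : cl2 psi -> cl2 phi -> cl2 (psi - phi).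
Proof. by move=> ? ?; apply/cl2D/cl2N. Qed.
Lemma cl2_ket i j : cl2 (ket R i j).
Proof. by split; rewrite ?reF_ket ?imF_ket; [exact: l2_rket|exact: l20]. Qed.

Lemma cipC psi phi : cip psi phi = cip phi psi.
Proof. by rewrite /cip ipC [X in _ + X]ipC. Qed.

Lemma cipDr (psi phi chi : fock R) : cl2 psi -> cl2 phi -> cl2 chi ->
  cip chi (psi + phi) = cip chi psi + cip chi phi.
Proof.
move=> [? ?] [? ?] [? ?]; rewrite /cip reFD imFD !ipDr //; ring.
Qed.
Lemma cipZr (a : R) (psi chi : fock R) : cl2 psi -> cl2 chi -> cip chi (a%:C *: psi) = a * cip chi psi.
Proof. by move=> [? ?] [? ?]; rewrite /cip reFZr imFZr !ipZr //; ring. Qed.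
Lemma cipBr (psi phi chi : fock R) : cl2 psi -> cl2 phi -> cl2 chi ->
  cip chi (psi - phi) = cip chi psi - cip chi phi.
Proof.
move=> [? ?] [? ?] [? ?]; rewrite /cip reFB imFB !ipBr //; ring.
Qed.

Lemma csqD psi phi : cl2 psi -> cl2 phi -> csq (psi + phi) = csq psi + 2 * cip psi phi + csq phi.
Proof.
move=> h1 h2; have h := cl2D h1 h2; rewrite /csq cipDr // !(cipC (psi + phi)) !cipDr //.
by rewrite (cipC phi psi); ring.
Qed.
Lemma csqZ (a : R) psi : cl2 psi -> csq (a%:C *: psi) = a ^+ 2 * csq psi.
Proof.
move=> h; have h' := cl2Z a%:C h.
by rewrite /csq cipZr // cipC cipZr //; ring.
Qed.
Lemma csq_ge0 psi : cl2 psi -> 0 <= csq psi.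
Proof. by move=> [? ?]; apply: addr_ge0; apply: sq_ge0. Qed.
Lemma csq_eq0 psi : cl2 psi -> csq psi = 0 -> psi = 0.
Proof.
move=> [lr li] h; have [h1 h2] := (sq_ge0 lr, sq_ge0 li).
have e : sq (reF psi) + sq (imF psi) = 0 by [].
have r0 := sq_eq0 lr (ltac:(lra)); have i0 := sq_eq0 li (ltac:(lra)).
by apply: fock_eq; rewrite ?r0 ?i0; apply/funext.
Qed.

Lemma ccauchy_schwarz psi phi : cl2 psi -> cl2 phi ->
  cip psi phi ^+ 2 <= csq psi * csq phi.
Proof.
move=> h1 h2; apply: discriminant_le0 => t.
have h := cl2Z t%:C h1; have := csq_ge0 (cl2D h h2).
by rewrite csqD // csqZ // (cipC _ phi) cipZr // (cipC phi); lra.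
Qed.

Lemma cip_ket i j psi : cl2 psi -> cip (ket R i j) psi = complex.Re (psi (i, j)).
Proof. by move=> [lr li]; rewrite /cip reF_ket imF_ket ip0l ip_rketl // addr0. Qed.

(** [cip] sees only the real part of the Hermitian product; multiplying the number state by the
    imaginary unit recovers the other half of a coefficient. *)
Lemma cip_iket i j psi : cl2 psi ->
  cip (Complex 0 1 *: ket R i j) psi = complex.Im (psi (i, j)).
Proof.
move=> [lr li]; rewrite /cip reFZ imFZ /= imF_ket reF_ket !scale0r !scaler0 subr0 add0r scale1r.
by rewrite ip0l add0r ip_rketl.
Qed.

Lemma csq_ket i j : csq (ket R i j) = 1.
Proof. by rewrite /csq cip_ket ?/ket ?eqxx //; apply: cl2_ket. Qed.

End ComplexFamilies.

(** * Groups generated by the squeezing generator *)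

Section SqueezingGroup.
Variable R : realType.
Implicit Types (psi phi chi : fock R) (x y : rfock R).

Lemma rgen0 : rgen (0 : rfock R) = 0.
Proof. by apply/funext => n; rewrite rgenE !mulr0 subrr. Qed.

Definition squeezing (r : R) psi : fock R := cx (rsqz r (reF psi)) (rsqz r (imF psi)).

Lemma reF_squeezing r psi : reF (squeezing r psi) = rsqz r (reF psi).
Proof. by []. Qed.
Lemma imF_squeezing r psi : imF (squeezing r psi) = rsqz r (imF psi).
Proof. by []. Qed.

Lemma squeezing_generated :
  unitary_group_generated_by (@squeezing_generator R) squeezing.
Proof.
split.
- move=> r c psi phi /ell2P[? ?] /ell2P[? ?].
  apply: fock_eq; rewrite ?(reFD, imFD) ?(reFZ, imFZ) !(reF_squeezing, imF_squeezing)
    ?(reFD, imFD) ?(reFZ, imFZ) rsqzD ?rsqzB ?rsqzD ?rsqzZ //; do ?[apply: l2B|apply: l2D]; exact: l2Z.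
- by move=> psi /ell2P[? ?]; apply: fock_eq; rewrite !(reF_squeezing, imF_squeezing) rsqz0.
- move=> r s psi /ell2P[? ?].
  by apply: fock_eq; rewrite !(reF_squeezing, imF_squeezing) rsqz_group.
- move=> r psi /ell2P[? ?]; rewrite !norm2E //; last by split; apply: l2_rsqz.
  by rewrite /csq /cip /= !(reF_squeezing, imF_squeezing) -![ip (rsqz _ _) _]/(sq _) !sq_rsqz.
move=> i j; set e := rket R (i, j); set K := ket R i j.
have le : l2 e by exact: l2_rket.
have lG : l2 (rgen e) by apply/rapid_l2/rapid_rgen/rapid_rket.
(* A number state is a real family, so the difference quotient has no imaginary part and the real
   estimate applies. *)
have nE h : h != 0 -> norm2 ((h^-1)%:C *: (squeezing h K - K) - squeezing_generator K) =
    (h ^- 2 * sq (rsqz h e - e - h *: rgen e))%:E.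
  move=> h0; have lV := l2_rsqz h le; have lB := l2B lV le; have lhG := l2Z h lG.
  have hr : reF ((h^-1)%:C *: (squeezing h K - K) - squeezing_generator K) =
      h^-1 *: (rsqz h e - e - h *: rgen e).
    rewrite reFB reFZr reFB reF_squeezing reF_rgen /K reF_ket -/e [RHS]scalerBr scalerA.
    by rewrite mulVf // scale1r.
  have hi : imF ((h^-1)%:C *: (squeezing h K - K) - squeezing_generator K) = 0.
    rewrite imFB imFZr imFB imF_squeezing imF_rgen /K imF_ket.
    have -> : rsqz h 0 = 0 by apply/funext => m; rewrite /rsqz ipC ip0l.
    by rewrite rgen0 !subr0 scaler0.
  have lS : l2 (h^-1 *: (rsqz h e - e - h *: rgen e)) by apply/l2Z/l2B.
  rewrite norm2E; last by split; rewrite ?hr ?hi //; exact: l20.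
  rewrite /csq /cip hr hi ip0l addr0 -[ip _ _]/(sq _) sqZ ?exprVn //; exact: l2B.
apply: cvg_trans (_ : (fun h => (h ^- 2 * sq (rsqz h e - e - h *: rgen e))%:E) @ (0 : R)^' --> _).
  apply: near_eq_cvg; near=> h; rewrite nE //.
  by near: h; exact: nbhs_dnbhs_neq.
apply: cvg_EFin; first exact: nearW.
exact: rsqz_derivative.
Unshelve. all: end_near. Qed.

Section GroupTheory.
Variable U : R -> op R.
Hypothesis hU : unitary_group_generated_by squeezing_generator U.

Lemma group_lin r c psi phi : cl2 psi -> cl2 phi ->
  U r (c *: psi + phi) = c *: U r psi + U r phi.
Proof. by case: hU => h _ _ _ _ /ell2P ? /ell2P ?; apply: h. Qed.

Lemma group_cl2 r psi : cl2 psi -> cl2 (U r psi).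
Proof.
by case: hU => _ _ _ h _ /ell2P hp; apply/ell2P; rewrite /ell2 /= h.
Qed.

Lemma group_csq r psi : cl2 psi -> csq (U r psi) = csq psi.
Proof.
move=> hp; case: hU => _ _ _ /(_ r psi) h _.
have := h (proj2 (ell2P psi) hp); rewrite !norm2E //; first by case.
exact: group_cl2.
Qed.

Lemma group_id psi : cl2 psi -> U 0 psi = psi.
Proof. by case: hU => _ h _ _ _ /ell2P; apply: h. Qed.

Lemma groupD r s psi : cl2 psi -> U (r + s) psi = U r (U s psi).
Proof. by case: hU => _ _ h _ _ /ell2P; apply: h. Qed.

Lemma groupK r psi : cl2 psi -> U r (U (- r) psi) = psi.
Proof. by move=> h; rewrite -groupD // subrr group_id. Qed.

Lemma groupNK r psi : cl2 psi -> U (- r) (U r psi) = psi.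
Proof. by move=> h; rewrite -groupD // addNr group_id. Qed.

Lemma cl20 : cl2 (0 : fock R).
Proof. by rewrite -(scale0r (ket R 0 0)); apply/cl2Z/cl2_ket. Qed.

Lemma group0 r : U r 0 = 0.
Proof.
have := group_lin r 1 cl20 cl20; rewrite scale1r addr0 scale1r => e.
by apply: (addrI (U r 0)); rewrite -e addr0.
Qed.

Lemma groupZ r c psi : cl2 psi -> U r (c *: psi) = c *: U r psi.
Proof. by move=> h; have := group_lin r c h cl20; rewrite group0 !addr0. Qed.

Lemma group_add r psi phi : cl2 psi -> cl2 phi -> U r (psi + phi) = U r psi + U r phi.
Proof. by move=> h1 h2; have := group_lin r 1 h1 h2; rewrite !scale1r. Qed.

Lemma group_sub r psi phi : cl2 psi -> cl2 phi -> U r (psi - phi) = U r psi - U r phi.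
Proof.
move=> h1 h2; have -> : psi - phi = -1 *: phi + psi by rewrite scaleN1r addrC.
by rewrite group_lin // scaleN1r addrC.
Qed.

Lemma group_cip r psi phi : cl2 psi -> cl2 phi -> cip (U r psi) (U r phi) = cip psi phi.
Proof.
move=> h1 h2; have := group_csq r (cl2D h1 h2); rewrite group_add //.
rewrite !csqD ?group_csq //; [lra|exact: group_cl2|exact: group_cl2].
Qed.

Lemma group_adjoint r psi phi : cl2 psi -> cl2 phi ->
  cip phi (U r psi) = cip (U (- r) phi) psi.
Proof.
move=> h1 h2; rewrite -(group_cip r (group_cl2 _ h2) h1).
by rewrite groupK.
Qed.

(** The group law moves the difference quotient at [s] to the one at 0; [U s] preserves the norm of
    the error [d h], and Cauchy-Schwarz bounds its pairing with [phi]. *)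
Lemma group_derive phi i j s : cl2 phi ->
  is_derive s (1 : R) (fun t => cip phi (U t (ket R i j)))
    (cip phi (U s (squeezing_generator (ket R i j)))).
Proof.
move=> hphi; set K := ket R i j; have hK : cl2 K by exact: cl2_ket.
have hG : cl2 (squeezing_generator K).
  split; rewrite ?reF_rgen ?imF_rgen /K ?reF_ket ?imF_ket.
    by apply/rapid_l2/rapid_rgen/rapid_rket.
  by rewrite rgen0; exact: l20.
pose d h := (h^-1)%:C *: (U h K - K) - squeezing_generator K.
have hd h : cl2 (d h) by apply/cl2B => //; apply/cl2Z/cl2B => //; exact: group_cl2.
have d0 : csq (d h) @[h --> (0 : R)^'] --> (0 : R).
  case: hU => _ _ _ _ /(_ i j)/fine_cvgP[_].
  rewrite (_ : _ \o _ = (fun h => csq (d h))) //.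
  by apply/funext => h; rewrite /= -/(d h) norm2E.
set D := cip _ _.
have cv : (fun h => h^-1 * (cip phi (U (s + h) K) - cip phi (U s K))) @ (0 : R)^' --> D.
  have -> : (fun h => h^-1 * (cip phi (U (s + h) K) - cip phi (U s K))) =
      (fun h => D + cip phi (U s (d h))).
    apply/funext => h; have hUK := group_cl2 h hK.
    have hB := cl2B hUK hK; have hA := cl2Z (h^-1)%:C hB.
    have hsK := group_cl2 s hK; have hsUK := group_cl2 s hUK.
    rewrite /d (group_sub s hA hG) (cipBr (group_cl2 s hA) (group_cl2 s hG) hphi).
    rewrite (groupZ s _ hB) (cipZr _ (group_cl2 s hB) hphi) (group_sub s hUK hK).
    rewrite (cipBr hsUK hsK hphi) -(groupD s h hK).
    by rewrite /D; ring.
  rewrite -[X in _ --> X]addr0; apply: cvgD; first exact: cvg_cst.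
  apply: norm_cvg0; apply: (@squeeze_cvgr _ _ _ _ (fun=> 0)
     (fun h => Num.sqrt (csq phi * csq (d h)))).
  - apply: nearW => h; rewrite normr_ge0 /= -sqrtr_sqr; apply: ler_wsqrtr.
    by rewrite -(group_csq s (hd h)); apply: ccauchy_schwarz => //; exact: group_cl2.
  - exact: cvg_cst.
  - rewrite -[X in _ --> X](sqrtr0 R); apply: continuous_cvg; first exact: sqrt_continuous.
    suff : (fun h => csq phi * csq (d h)) @ (0 : R)^' --> csq phi * 0 by rewrite mulr0.
    by apply: cvgMr.
have cv' : h^-1 *: ((fun t => cip phi (U t K)) (h *: 1 + s) - cip phi (U s K))
    @[h --> (0 : R)^'] --> D.
  apply: cvg_trans cv; apply: near_eq_cvg; near=> h.
  by rewrite /= /GRing.scale /= mulr1 (addrC h).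
apply: DeriveDef; first exact: cvgP cv'.
exact: cvg_lim cv'.
Unshelve. all: end_near. Qed.

End GroupTheory.

(** Acting on states instead of coefficients transposes the matrix of [rgen]; skew symmetry gives
    the minus sign in the equation for the pairings. The factors [sqrt 0] remove the terms in which
    [.-1] is a default. *)
Lemma generator_ket i j : squeezing_generator (ket R i j) =
  (Num.sqrt i.+1%:R * Num.sqrt j.+1%:R)%:C *: ket R i.+1 j.+1 -
  (Num.sqrt i%:R * Num.sqrt j%:R)%:C *: ket R i.-1 j.-1.
Proof.
apply: fock_eq; last first.
  by rewrite imF_rgen imFB !imFZr !imF_ket rgen0 !scaler0 subr0.
rewrite reF_rgen reFB !reFZr !reF_ket; apply/funext => -[k l].
rewrite rgenE !fctE /GRing.scale /rket /= !xpair_eqE; congr (_ - _).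
  case: k => [|k]; first by rewrite sqrtr0 !mul0r mulr0.
  case: l => [|l]; first by rewrite sqrtr0 !mul0r andbF !mulr0.
  rewrite ?eqSS; case: (eqVneq k i) => [->|_] /=; last by rewrite !mulr0.
  by case: (eqVneq l j) => [->|_] /=; rewrite ?mulr0 ?mulr1.
case: i => [|i]; first by rewrite /= sqrtr0 !mul0r !mulr0.
case: j => [|j]; first by rewrite /= sqrtr0 andbF !mulr0 mul0r.
rewrite ?eqSS; case: (eqVneq k i) => [->|_] /=; last by rewrite !mulr0.
by case: (eqVneq l j) => [->|_] /=; rewrite ?mulr0 ?mulr1.
Qed.

Lemma group_unique_ket U W i j s :
  unitary_group_generated_by squeezing_generator U ->
  unitary_group_generated_by squeezing_generator W ->
  U s (ket R i j) = W s (ket R i j).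
Proof.
move=> hU hW.
have hk k l := cl2_ket R k l.
pose z phi t : rfock R := fun n => cip phi (U t (ket R n.1 n.2)) - cip phi (W t (ket R n.1 n.2)).
have hz phi : cl2 phi -> forall t n, z phi t n = 0.
  move=> hphi; apply: (@bounded_solution_eq0 R (z phi) (2 * Num.sqrt (csq phi))).
  - move=> t [k l].
    apply: is_derive_eq (is_derive_fB (group_derive hU k l t hphi)
      (group_derive hW k l t hphi)) _.
    rewrite generator_ket !group_sub //; try exact: cl2Z.
    rewrite !groupZ // !cipBr //; try by do ?[apply: cl2Z|apply: group_cl2].
    rewrite !cipZr //; try by apply: group_cl2.
    by rewrite rgenE /z /=; ring.
  - move=> t n; apply: le_trans (ler_normB _ _) _; rewrite mulrDl mul1r.
    apply: lerD; rewrite -sqrtr_sqr; apply: ler_wsqrtr.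
      apply: le_trans (ccauchy_schwarz hphi (group_cl2 hU t (hk _ _))) _.
      by rewrite group_csq // csq_ket mulr1.
    apply: le_trans (ccauchy_schwarz hphi (group_cl2 hW t (hk _ _))) _.
    by rewrite group_csq // csq_ket mulr1.
  - by move=> n; rewrite /z !group_id // subrr.
have lU := group_cl2 hU s (hk i j); have lW := group_cl2 hW s (hk i j).
have lUW := cl2B lU lW.
apply/eqP; rewrite -subr_eq0; apply/eqP; apply: csq_eq0 => //.
(* For [phi] the difference itself, the vanishing pairing is its squared norm. *)
by rewrite {1}/csq cipBr //; exact: (hz _ lUW s (i, j)).
Qed.

(** The coefficients of [U s psi] are pairings of [psi] with [U (- s)] applied to number states,
    where both groups agree. *)
Lemma group_unique U W psi s :
  unitary_group_generated_by squeezing_generator U ->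
  unitary_group_generated_by squeezing_generator W ->
  cl2 psi -> U s psi = W s psi.
Proof.
move=> hU hW hpsi; have hk k l := cl2_ket R k l.
have lU := group_cl2 hU s hpsi; have lW := group_cl2 hW s hpsi.
apply: fock_eq; apply/funext => -[i j].
  rewrite /reF -!cip_ket // (group_adjoint hU) // (group_adjoint hW) //.
  by rewrite (group_unique_ket _ _ _ hU hW).
rewrite /imF -!cip_iket // (group_adjoint hU) // ?(group_adjoint hW) //; try exact: cl2Z.
by rewrite (groupZ hU) // (groupZ hW) // (group_unique_ket _ _ _ hU hW).
Qed.

End SqueezingGroup.

(** * Ladder algebra *)

Section LadderAlgebra.
Variable R : realType.
Implicit Types (psi phi : fock R) (c : R[i]).

Lemma a1D psi phi : a1 (psi + phi) = a1 psi + a1 phi.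
Proof. by apply/funext => n; rewrite /a1 !fctE mulrDr. Qed.
Lemma a2D psi phi : a2 (psi + phi) = a2 psi + a2 phi.
Proof. by apply/funext => n; rewrite /a2 !fctE mulrDr. Qed.
Lemma a1dD psi phi : a1d (psi + phi) = a1d psi + a1d phi.
Proof. by apply/funext => n; rewrite /a1d !fctE mulrDr. Qed.
Lemma a2dD psi phi : a2d (psi + phi) = a2d psi + a2d phi.
Proof. by apply/funext => n; rewrite /a2d !fctE mulrDr. Qed.

Lemma a1Z c psi : a1 (c *: psi) = c *: a1 psi.
Proof. by apply/funext => n; rewrite /a1 !fctE /GRing.scale /= mulrCA. Qed.
Lemma a2Z c psi : a2 (c *: psi) = c *: a2 psi.
Proof. by apply/funext => n; rewrite /a2 !fctE /GRing.scale /= mulrCA. Qed.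
Lemma a1dZ c psi : a1d (c *: psi) = c *: a1d psi.
Proof. by apply/funext => n; rewrite /a1d !fctE /GRing.scale /= mulrCA. Qed.
Lemma a2dZ c psi : a2d (c *: psi) = c *: a2d psi.
Proof. by apply/funext => n; rewrite /a2d !fctE /GRing.scale /= mulrCA. Qed.

Lemma a1B psi phi : a1 (psi - phi) = a1 psi - a1 phi.
Proof. by rewrite a1D -(scaleN1r phi) a1Z scaleN1r. Qed.
Lemma a2B psi phi : a2 (psi - phi) = a2 psi - a2 phi.
Proof. by rewrite a2D -(scaleN1r phi) a2Z scaleN1r. Qed.
Lemma a1dB psi phi : a1d (psi - phi) = a1d psi - a1d phi.
Proof. by rewrite a1dD -(scaleN1r phi) a1dZ scaleN1r. Qed.
Lemma a2dB psi phi : a2d (psi - phi) = a2d psi - a2d phi.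
Proof. by rewrite a2dD -(scaleN1r phi) a2dZ scaleN1r. Qed.

Definition ladder_lin :=
  (a1B, a2B, a1dB, a2dB, a1D, a2D, a1dD, a2dD, a1Z, a2Z, a1dZ, a2dZ).

Lemma a1_a1d psi : a1 (a1d psi) = a1d (a1 psi) + psi.
Proof. by apply: fock_eq; rewrite ?(reFD, imFD) ?reF_ladder ?imF_ladder rb1_rb1d. Qed.
Lemma a2_a2d psi : a2 (a2d psi) = a2d (a2 psi) + psi.
Proof. by apply: fock_eq; rewrite ?(reFD, imFD) ?reF_ladder ?imF_ladder rb2_rb2d. Qed.
Lemma a2_a1 psi : a2 (a1 psi) = a1 (a2 psi).
Proof. by apply: fock_eq; rewrite ?reF_ladder ?imF_ladder rb2_rb1. Qed.
Lemma a1_a2d psi : a1 (a2d psi) = a2d (a1 psi).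
Proof. by apply: fock_eq; rewrite ?reF_ladder ?imF_ladder rb1_rb2d. Qed.
Lemma a2_a1d psi : a2 (a1d psi) = a1d (a2 psi).
Proof. by apply: fock_eq; rewrite ?reF_ladder ?imF_ladder rb2_rb1d. Qed.
Lemma a2d_a1d psi : a2d (a1d psi) = a1d (a2d psi).
Proof. by apply: fock_eq; rewrite ?reF_ladder ?imF_ladder rb2d_rb1d. Qed.

Definition ccr := (a1_a1d, a2_a2d, a2_a1, a1_a2d, a2_a1d, a2d_a1d).

Lemma commutatorE (A B : op R) psi : commutator A B psi = A (B psi) - B (A psi).
Proof. by []. Qed.

Lemma SplusE r psi : Splus r psi = (cosh (2 * r))%:C *: a1d (a2 psi)
  - (sinh (2 * r) / 2)%:C *: (a1d (a1d psi) + a2 (a2 psi)).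
Proof. by []. Qed.

Lemma SminusE r psi : Sminus r psi = (cosh (2 * r))%:C *: a2d (a1 psi)
  - (sinh (2 * r) / 2)%:C *: (a1 (a1 psi) + a2d (a2d psi)).
Proof. by []. Qed.

Lemma SzE psi : Sz psi = 2^-1 *: (a1d (a1 psi) - a2d (a2 psi)).
Proof. by []. Qed.

Lemma numopE psi : numop psi = a1d (a1 psi) + a2d (a2 psi).
Proof. by []. Qed.

Lemma two_neq0 : 2 != 0 :> R[i]. Proof. by rewrite pnatr_eq0. Qed.

Lemma real_half (t : R) : (t / 2)%:C = t%:C / 2.
Proof. by rewrite rmorphM fmorphV rmorph_nat. Qed.
Lemma real_sqrB (t u : R) : (t ^+ 2 - u ^+ 2)%:C = t%:C ^+ 2 - u%:C ^+ 2.
Proof. by rewrite rmorphB !rmorphXn. Qed.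
Lemma real_sqrD (t u : R) : (t ^+ 2 + u ^+ 2)%:C = t%:C ^+ 2 + u%:C ^+ 2.
Proof. by rewrite rmorphD !rmorphXn. Qed.
Lemma real_double (t u : R) : (2 * t * u)%:C = 2 * t%:C * u%:C.
Proof. by rewrite !rmorphM rmorph_nat. Qed.

Ltac coefficients := rewrite ?ladder_lin ?ccr ?ladder_lin ?ccr ?ladder_lin ?ccr;
  apply/funext => n; rewrite !fctE /GRing.scale /=.

Lemma commutator_Sz_Splus (r : R) : commutator Sz (Splus r) = Splus r.
Proof.
apply/funext => psi; rewrite commutatorE !SzE !SplusE.
by coefficients; field.
Qed.

Lemma commutator_Sz_Sminus (r : R) : commutator Sz (Sminus r) = - Sminus r.
Proof.
apply/funext => psi; rewrite commutatorE !SzE [RHS]/(- _) !SminusE.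
by coefficients; field.
Qed.

Lemma commutator_Splus_Sminus (r : R) : commutator (Splus r) (Sminus r) = 2 *: Sz.
Proof.
apply/funext => psi; rewrite commutatorE !SplusE !SminusE.
have -> : ((2 : R[i]) *: @Sz R) psi = a1d (a1 psi) - a2d (a2 psi).
  apply/funext => n; rewrite [LHS](_ : _ = 2 * (2^-1 * (a1d (a1 psi) - a2d (a2 psi)) n)) //.
  by rewrite mulVKf // two_neq0.
set C := (cosh _)%:C; set S := (_ / 2)%:C.
(* The terms in [C * S] cancel and the commutator is [C ^+ 2 - 4 * S ^+ 2] times the difference of
   the two occupation numbers, [S] being half of sinh(2r). *)
have e : C ^+ 2 - 4 * S ^+ 2 = 1.
  rewrite [RHS](_ : 1 = C ^+ 2 - (sinh (2 * r))%:C ^+ 2); last first.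
    by rewrite /C -real_sqrB cosh2Bsinh2 rmorph1.
  rewrite /S (real_half (sinh (2 * r))) -/C; move: C (_%:C) => u v.
  by field.
rewrite -[RHS]scale1r -[X in _ = X *: _]e.
by coefficients; ring.
Qed.

Lemma numop_a1d_a1d psi : numop (a1d (a1d psi)) = a1d (a1d (numop psi)) + 2 *: a1d (a1d psi).
Proof. by rewrite !numopE; coefficients; ring. Qed.
Lemma numop_a2d_a2d psi : numop (a2d (a2d psi)) = a2d (a2d (numop psi)) + 2 *: a2d (a2d psi).
Proof. by rewrite !numopE; coefficients; ring. Qed.
Lemma numop_a1_a1 psi : numop (a1 (a1 psi)) = a1 (a1 (numop psi)) - 2 *: a1 (a1 psi).
Proof. by rewrite !numopE; coefficients; ring. Qed.
Lemma numop_a2_a2 psi : numop (a2 (a2 psi)) = a2 (a2 (numop psi)) - 2 *: a2 (a2 psi).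
Proof. by rewrite !numopE; coefficients; ring. Qed.

Lemma changes_number_a1d_a1d : changes_number_by 2 (@a1d R \o @a1d R).
Proof.
by move=> lam psi h; rewrite /= numop_a1d_a1d h !ladder_lin rmorph_nat [RHS]scalerDl.
Qed.
Lemma changes_number_a2d_a2d : changes_number_by 2 (@a2d R \o @a2d R).
Proof.
by move=> lam psi h; rewrite /= numop_a2d_a2d h !ladder_lin rmorph_nat [RHS]scalerDl.
Qed.
Lemma changes_number_a1_a1 : changes_number_by (- 2) (@a1 R \o @a1 R).
Proof.
by move=> lam psi h; rewrite /= numop_a1_a1 h !ladder_lin rmorphN rmorph_nat [RHS]scalerBl.
Qed.
Lemma changes_number_a2_a2 : changes_number_by (- 2) (@a2 R \o @a2 R).
Proof.
by move=> lam psi h; rewrite /= numop_a2_a2 h !ladder_lin rmorphN rmorph_nat [RHS]scalerBl.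
Qed.

Lemma commutator_numop_Splus (r : R) psi : commutator numop (Splus r) psi =
  (sinh (2 * r))%:C *: (a2 (a2 psi) - a1d (a1d psi)).
Proof.
rewrite commutatorE !SplusE !numopE.
have -> : (sinh (2 * r))%:C = 2 * (sinh (2 * r) / 2)%:C.
  by rewrite (real_half (sinh (2 * r))) [RHS]mulrC divfK // two_neq0.
by coefficients; ring.
Qed.

Lemma commutator_numop_Sminus (r : R) psi : commutator numop (Sminus r) psi =
  (sinh (2 * r))%:C *: (a1 (a1 psi) - a2d (a2d psi)).
Proof.
rewrite commutatorE !SminusE !numopE.
have -> : (sinh (2 * r))%:C = 2 * (sinh (2 * r) / 2)%:C.
  by rewrite (real_half (sinh (2 * r))) [RHS]mulrC divfK // two_neq0.
by coefficients; ring.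
Qed.

Lemma numop_JSplus psi : numop (JSplus psi) = JSplus (numop psi).
Proof. by rewrite /JSplus /= !numopE; coefficients; ring. Qed.
Lemma numop_JSminus psi : numop (JSminus psi) = JSminus (numop psi).
Proof. by rewrite /JSminus /= !numopE; coefficients; ring. Qed.
Lemma numop_Sz psi : numop (Sz psi) = Sz (numop psi).
Proof. by rewrite !SzE !numopE; coefficients; ring. Qed.

(** The right side is [A1d] after [A2] on complex families: the squeezed generator has
    Jordan-Schwinger form in the Bogoliubov operators, by the double-argument formulas. *)
Lemma Splus_bogoliubov (r : R) psi (c := (cosh r)%:C) (s := (sinh r)%:C)
    (phi := c *: a2 psi - s *: a1d psi) :
  Splus r psi = c *: a1d phi - s *: a2 phi.
Proof.
rewrite SplusE (real_half (sinh (2 * r))) cosh2 sinh2 real_sqrD real_double -/c -/s /phi.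
by coefficients; field.
Qed.

Lemma Sminus_bogoliubov (r : R) psi (c := (cosh r)%:C) (s := (sinh r)%:C)
    (phi := c *: a1 psi - s *: a2d psi) :
  Sminus r psi = c *: a2d phi - s *: a1 phi.
Proof.
rewrite SminusE (real_half (sinh (2 * r))) cosh2 sinh2 real_sqrD real_double -/c -/s /phi.
by coefficients; field.
Qed.

(** The constant comes from normal ordering, one sinh^2 r for each mode. *)
Lemma numop_bogoliubov (r : R) psi (c := (cosh r)%:C) (s := (sinh r)%:C)
    (phi1 := c *: a1 psi - s *: a2d psi) (phi2 := c *: a2 psi - s *: a1d psi) :
  (c *: a1d phi1 - s *: a2 phi1) + (c *: a2d phi2 - s *: a1 phi2) =
  (cosh (2 * r))%:C *: (a1d (a1 psi) + a2d (a2 psi))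
  - (sinh (2 * r))%:C *: (a1d (a2d psi) + a1 (a2 psi))
  + (2 * sinh r ^+ 2)%:C *: psi.
Proof.
have -> : (2 * sinh r ^+ 2)%:C = 2 * s ^+ 2 by rewrite expr2 mulrA real_double expr2 mulrA.
rewrite cosh2 sinh2 real_sqrD real_double -/c -/s /phi1 /phi2.
by coefficients; ring.
Qed.

(** In the difference the pair terms and the ordering constants cancel, and cosh^2 - sinh^2 = 1
    leaves an operator free of [r]. *)
Lemma Sz_bogoliubov (r : R) psi (c := (cosh r)%:C) (s := (sinh r)%:C)
    (phi1 := c *: a1 psi - s *: a2d psi) (phi2 := c *: a2 psi - s *: a1d psi) :
  2^-1 *: ((c *: a1d phi1 - s *: a2 phi1) - (c *: a2d phi2 - s *: a1 phi2)) = Sz psi.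
Proof.
have e : c ^+ 2 - s ^+ 2 = 1 by rewrite -real_sqrB cosh2Bsinh2 rmorph1.
rewrite SzE -[RHS]scale1r -[X in _ = X *: _]e /phi1 /phi2.
by coefficients; ring.
Qed.

End LadderAlgebra.

(** * Smooth vectors *)

Section SmoothVectors.
Variable R : realType.
Implicit Types (psi phi : fock R) (x : rfock R).

Definition rnum x : rfock R := rb1d (rb1 x) + rb2d (rb2 x).

Lemma rnumE x n : rnum x n = (n.1 + n.2)%:R * x n.
Proof. by rewrite /rnum !fctE rb1d_rb1 rb2d_rb2 natrD mulrDl. Qed.

Lemma iter_rnumE k x n : iter k (@rnum) x n = (n.1 + n.2)%:R ^+ k * x n.
Proof. by elim: k => [|k IH] /=; rewrite ?mul1r // rnumE IH exprS mulrA. Qed.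

Lemma rapid_rnum x : rapid x -> rapid (rnum x).
Proof.
by move=> h; apply: rapidD; [apply/rapid_rb1d/rapid_rb1|apply/rapid_rb2d/rapid_rb2].
Qed.

Lemma rapidP x : rapid x <-> forall k, l2 (iter k rnum x).
Proof.
split=> [h k|h k].
  by apply: rapid_l2; elim: k => //= k; exact: rapid_rnum.
pose M j := Num.sqrt (sq (iter j rnum x)).
have hM j n : `|(n.1 + n.2)%:R ^+ j * x n| <= M j.
  by rewrite -iter_rnumE -sqrtr_sqr; apply: ler_wsqrtr; exact: sqr_le_sq.
(* The number operator weighs by n1 + n2, [rapid] by n1 + n2 + 1: off the vacuum this costs 2^k, and
   at the vacuum, where the former vanishes, [M 0] takes over. *)
exists (2 ^+ k * M k + M 0%N) => n.
have M0 j : 0 <= M j by exact: sqrtr_ge0.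
case: (posnP (n.1 + n.2)) => [n0|n0].
  have := hM 0%N n; rewrite n0 expr0 expr1n !mul1r => h0.
  by apply: le_trans h0 _; rewrite lerDr mulr_ge0 ?exprn_ge0.
apply: (@le_trans _ _ (2 ^+ k * M k)); last by rewrite lerDl.
apply: le_trans (ler_wpM2l (_ : 0 <= 2 ^+ k) (hM k n)); last by rewrite exprn_ge0.
rewrite normrM (ger0_norm (_ : 0 <= (n.1 + n.2)%:R ^+ k)) ?exprn_ge0 // mulrA -exprMn.
rewrite ler_wpM2r // lerXn2r ?nnegrE ?mulr_ge0 // -natrM ler_nat; lia.
Qed.

Lemma reF_numop psi : reF (numop psi) = rnum (reF psi).
Proof. by rewrite numopE reFD !reF_ladder. Qed.
Lemma imF_numop psi : imF (numop psi) = rnum (imF psi).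
Proof. by rewrite numopE imFD !imF_ladder. Qed.

Lemma smoothP psi : smooth psi <-> rapid (reF psi) /\ rapid (imF psi).
Proof.
have hr k : reF (iter k numop psi) = iter k rnum (reF psi).
  by elim: k => //= k <-; exact: reF_numop.
have hi k : imF (iter k numop psi) = iter k rnum (imF psi).
  by elim: k => //= k <-; exact: imF_numop.
split=> [h|[/rapidP h1 /rapidP h2] k]; last by apply/ell2P; split; rewrite ?hr ?hi.
split; apply/rapidP => k; have /ell2P[] := h k; by rewrite hr hi.
Qed.

Lemma smooth_cl2 psi : smooth psi -> cl2 psi.
Proof. by move=> /smoothP[h1 h2]; split; apply: rapid_l2. Qed.

Lemma smoothD psi phi : smooth psi -> smooth phi -> smooth (psi + phi).
Proof.
by move=> /smoothP[? ?] /smoothP[? ?]; apply/smoothP; rewrite reFD imFD; split; apply: rapidD.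
Qed.
Lemma smoothZ c psi : smooth psi -> smooth (c *: psi).
Proof.
move=> /smoothP[? ?]; apply/smoothP; rewrite reFZ imFZ.
by split; [apply: rapidB|apply: rapidD]; apply: rapidZ.
Qed.
Lemma smoothB psi phi : smooth psi -> smooth phi -> smooth (psi - phi).
Proof. by move=> ? ?; rewrite -(scaleN1r phi); apply/smoothD/smoothZ. Qed.
Lemma smooth_a1 psi : smooth psi -> smooth (a1 psi).
Proof.
by move=> /smoothP[? ?]; apply/smoothP; rewrite reF_a1 imF_a1; split; apply: rapid_rb1.
Qed.
Lemma smooth_a2 psi : smooth psi -> smooth (a2 psi).
Proof.
by move=> /smoothP[? ?]; apply/smoothP; rewrite reF_a2 imF_a2; split; apply: rapid_rb2.
Qed.
Lemma smooth_a1d psi : smooth psi -> smooth (a1d psi).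
Proof.
by move=> /smoothP[? ?]; apply/smoothP; rewrite reF_a1d imF_a1d; split; apply: rapid_rb1d.
Qed.
Lemma smooth_a2d psi : smooth psi -> smooth (a2d psi).
Proof.
by move=> /smoothP[? ?]; apply/smoothP; rewrite reF_a2d imF_a2d; split; apply: rapid_rb2d.
Qed.
Lemma smooth_ket i j : smooth (ket R i j).
Proof. by apply/smoothP; rewrite reF_ket imF_ket; split; [exact: rapid_rket|exact: rapid0]. Qed.

(** [rnum] after [rsqz s] is [rsqz s] after [N], the number operator of the Bogoliubov modes at
    [- s]. As [N] preserves rapid decrease and [rsqz s] preserves [l2], all powers of [rnum] stay in
    [l2]. *)
Lemma rapid_rsqz s x : rapid x -> rapid (rsqz s x).
Proof.
move=> hx; pose N y := A1d (- s) (A1 (- s) y) + A2d (- s) (A2 (- s) y).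
have rN y : rapid y -> rapid (N y).
  move=> hy; apply: rapidD; first exact/rapid_A1d/rapid_A1.
  exact/rapid_A2d/rapid_A2.
have A0 (y : rfock R) : [/\ A1 0 y = rb1 y, A2 0 y = rb2 y, A1d 0 y = rb1d y & A2d 0 y = rb2d y].
  by rewrite /A1 /A2 /A1d /A2d cosh0 sinh0; split; rewrite scale1r scale0r subr0.
have VN y : rapid y -> rnum (rsqz s y) = rsqz s (N y).
  move=> hy; have [h1 h2] := (rapid_A1 (- s) hy, rapid_A2 (- s) hy).
  rewrite rsqzD; [|exact/rapid_l2/rapid_A1d|exact/rapid_l2/rapid_A2d].
  rewrite rsqz_A1d // rsqz_A2d // rsqz_A1 // rsqz_A2 // addNr.
  have [e1 e2 _ _] := A0 (rsqz s y).
  have [_ _ e3 _] := A0 (rb1 (rsqz s y)).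
  have [_ _ _ e4] := A0 (rb2 (rsqz s y)).
  by rewrite e1 e2 e3 e4.
have hk k : iter k rnum (rsqz s x) = rsqz s (iter k N x) /\ rapid (iter k N x).
  by elim: k => //= k [-> h]; rewrite VN //; split => //; exact: rN.
by apply/rapidP => k; have [-> h] := hk k; apply/l2_rsqz/rapid_l2.
Qed.

End SmoothVectors.

(** * Moving operators across an arbitrary squeezing group *)

Section Intertwining.
Variable R : realType.
Variable U : R -> op R.
Hypothesis hU : unitary_group_generated_by squeezing_generator U.
Implicit Types (psi phi : fock R) (A B : op R).

(** Uniqueness enters here: the action of any [U] on ladder operators is read off from the explicit
    matrix. *)
Lemma group_squeezing r psi : cl2 psi -> U r psi = squeezing r psi.
Proof. by move=> h; apply: group_unique => //; exact: squeezing_generated. Qed.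

Lemma group_smooth r psi : smooth psi -> smooth (U r psi).
Proof.
move=> h; rewrite group_squeezing; last exact: smooth_cl2.
by move/smoothP: h => [? ?]; apply/smoothP; split; apply: rapid_rsqz.
Qed.

Lemma group_a1 r psi : smooth psi -> U r (a1 psi) =
  (cosh r)%:C *: a1 (U r psi) - (sinh r)%:C *: a2d (U r psi).
Proof.
move=> h; rewrite !group_squeezing; [|exact: smooth_cl2|exact/smooth_cl2/smooth_a1].
move/smoothP: h => [? ?]; apply: fock_eq; rewrite ?reFB ?imFB ?reFZr ?imFZr
  ?reF_ladder ?imF_ladder !(reF_squeezing, imF_squeezing) ?reF_ladder ?imF_ladder.
- exact: rsqz_rb1.
- exact: rsqz_rb1.
Qed.
Lemma group_a2 r psi : smooth psi -> U r (a2 psi) =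
  (cosh r)%:C *: a2 (U r psi) - (sinh r)%:C *: a1d (U r psi).
Proof.
move=> h; rewrite !group_squeezing; [|exact: smooth_cl2|exact/smooth_cl2/smooth_a2].
move/smoothP: h => [? ?]; apply: fock_eq; rewrite ?reFB ?imFB ?reFZr ?imFZr
  ?reF_ladder ?imF_ladder !(reF_squeezing, imF_squeezing) ?reF_ladder ?imF_ladder.
- exact: rsqz_rb2.
- exact: rsqz_rb2.
Qed.
Lemma group_a1d r psi : smooth psi -> U r (a1d psi) =
  (cosh r)%:C *: a1d (U r psi) - (sinh r)%:C *: a2 (U r psi).
Proof.
move=> h; rewrite !group_squeezing; [|exact: smooth_cl2|exact/smooth_cl2/smooth_a1d].
move/smoothP: h => [? ?]; apply: fock_eq; rewrite ?reFB ?imFB ?reFZr ?imFZr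
  ?reF_ladder ?imF_ladder !(reF_squeezing, imF_squeezing) ?reF_ladder ?imF_ladder.
- exact: rsqz_rb1d.
- exact: rsqz_rb1d.
Qed.
Lemma group_a2d r psi : smooth psi -> U r (a2d psi) =
  (cosh r)%:C *: a2d (U r psi) - (sinh r)%:C *: a1 (U r psi).
Proof.
move=> h; rewrite !group_squeezing; [|exact: smooth_cl2|exact/smooth_cl2/smooth_a2d].
move/smoothP: h => [? ?]; apply: fock_eq; rewrite ?reFB ?imFB ?reFZr ?imFZr
  ?reF_ladder ?imF_ladder !(reF_squeezing, imF_squeezing) ?reF_ladder ?imF_ladder.
- exact: rsqz_rb2d.
- exact: rsqz_rb2d.
Qed.

Lemma group_JSplus r psi : smooth psi -> U r (JSplus psi) = Splus r (U r psi).
Proof.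
move=> h; rewrite [JSplus psi]/(a1d (a2 psi)) Splus_bogoliubov.
by rewrite group_a1d ?group_a2 //; exact: smooth_a2.
Qed.

Lemma group_JSminus r psi : smooth psi -> U r (JSminus psi) = Sminus r (U r psi).
Proof.
move=> h; rewrite [JSminus psi]/(a2d (a1 psi)) Sminus_bogoliubov.
by rewrite group_a2d ?group_a1 //; exact: smooth_a1.
Qed.

Lemma group_Sz r psi : smooth psi -> U r (Sz psi) = Sz (U r psi).
Proof.
move=> h; have [h1 h2] := (smooth_a1 h, smooth_a2 h).
have [h1' h2'] := (smooth_a1d h1, smooth_a2d h2).
rewrite SzE (groupZ hU); last exact/smooth_cl2/smoothB.
rewrite (group_sub hU); try exact: smooth_cl2.
by rewrite group_a1d // group_a2d // group_a1 // group_a2 // Sz_bogoliubov.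
Qed.

Lemma group_numop r psi : smooth psi -> U r (numop psi) =
  (cosh (2 * r))%:C *: (a1d (a1 (U r psi)) + a2d (a2 (U r psi)))
  - (sinh (2 * r))%:C *: (a1d (a2d (U r psi)) + a1 (a2 (U r psi)))
  + (2 * sinh r ^+ 2)%:C *: U r psi.
Proof.
move=> h; have [h1 h2] := (smooth_a1 h, smooth_a2 h).
have [h1' h2'] := (smooth_a1d h1, smooth_a2d h2).
rewrite numopE (group_add hU); try exact: smooth_cl2.
by rewrite group_a1d // group_a2d // group_a1 // group_a2 // numop_bogoliubov.
Qed.

Lemma conj_byE r A B psi : smooth psi ->
  (forall phi, smooth phi -> U r (A phi) = B (U r phi)) -> conj_by U r A psi = B psi.
Proof.
move=> h hAB; rewrite /conj_by /= hAB ?(groupK hU) //; first exact: smooth_cl2.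
exact: group_smooth.
Qed.

(** [B] is the conjugate of [A], so the commutator is the conjugate of that of [numop] and [A],
    which vanishes. *)
Lemma commutator_conj_numop r A B :
    (forall phi, smooth phi -> smooth (A phi)) ->
    (forall phi, smooth phi -> U r (A phi) = B (U r phi)) ->
    (forall phi, numop (A phi) = A (numop phi)) ->
  eq_on_smooth (commutator (conj_by U r numop) B) 0.
Proof.
move=> sA hAB hN psi h; rewrite commutatorE /conj_by /=.
have hp : smooth (U (- r) psi) by exact: group_smooth.
have e : psi = U r (U (- r) psi) by rewrite (groupK hU) //; exact: smooth_cl2.
have hn : smooth (numop (U (- r) psi)).
  by rewrite numopE; apply: smoothD; [exact/smooth_a1d/smooth_a1|exact/smooth_a2d/smooth_a2].
rewrite {1}e -hAB // (groupNK hU); last exact/smooth_cl2/sA.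
by rewrite hN hAB // subrr.
Qed.

Lemma smooth_JSplus psi : smooth psi -> smooth (JSplus psi).
Proof. by move=> h; apply/smooth_a1d/smooth_a2. Qed.
Lemma smooth_JSminus psi : smooth psi -> smooth (JSminus psi).
Proof. by move=> h; apply/smooth_a2d/smooth_a1. Qed.
Lemma smooth_Sz psi : smooth psi -> smooth (Sz psi).
Proof.
move=> h; rewrite SzE; apply/smoothZ/smoothB; first exact/smooth_a1d/smooth_a1.
exact/smooth_a2d/smooth_a2.
Qed.

End Intertwining.

(** * Spin sectors *)

Section Sectors.
Variable R : realType.
Implicit Types (psi phi : fock R) (W : set (fock R)).

Lemma ketE i j n : ket R i j n = (n == (i, j))%:R.
Proof. by rewrite /ket; case: eqP. Qed.

(** [inord n.2] is a genuine index wherever it is read, since [n.1 + n.2 = m] bounds [n.2]. *)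
Lemma sum_ketE m (c : 'I_m.+1 -> R[i]) (n : nat * nat) :
  (\sum_(k < m.+1) c k *: ket R (m - k) k) n =
  if (n.1 + n.2 == m)%N then c (inord n.2) else 0.
Proof.
rewrite fct_sumE; case: ifPn => [/eqP nm|nm].
  have hn : (n.2 < m.+1)%N by rewrite ltnS -nm leq_addl.
  rewrite (bigD1 (inord n.2)) //= big1 ?addr0.
    have e : (m - n.2 = n.1)%N by rewrite -nm addnK.
    by rewrite fctE /GRing.scale /= ketE inordK // e -surjective_pairing eqxx mulr1.
  move=> k kn; rewrite fctE /GRing.scale /= ketE; case: eqP => [e|_]; last by rewrite mulr0.
  by case/eqP: kn; apply: val_inj; rewrite /= e /= inordK.
rewrite big1 // => k _; rewrite fctE /GRing.scale /= ketE; case: eqP => [e|_].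
  by rewrite e /= subnK ?eqxx // -ltnS in nm.
exact: mulr0.
Qed.

Lemma sectorP m psi : sector m psi <-> forall n, (n.1 + n.2 != m)%N -> psi n = 0.
Proof.
split=> [[c ->] n nm|h]; first by rewrite sum_ketE (negbTE nm).
exists (fun k : 'I_m.+1 => psi (m - k, val k)%N); apply/funext => -[i j]; rewrite sum_ketE /=.
case: ifPn => [/eqP ijm|nm]; last exact: h (i, j) nm.
rewrite inordK; last by rewrite ltnS -ijm leq_addl.
by rewrite -ijm addnK.
Qed.

Lemma sector_smooth m psi : sector m psi -> smooth psi.
Proof.
case=> c ->; elim/big_ind: _ => [|*|k _].
- by rewrite -(scale0r (ket R 0 0)); apply/smoothZ/smooth_ket.
- exact: smoothD.
- exact/smoothZ/smooth_ket.
Qed.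

Lemma subspace_sector m : Defs.subspace (@sector R m).
Proof.
split; first by apply: (proj2 (sectorP m 0)).
move=> c psi phi /(proj1 (sectorP m psi)) h1 /(proj1 (sectorP m phi)) h2.
by apply: (proj2 (sectorP m _)) => n nm; rewrite !fctE h1 // h2 // scaler0 addr0.
Qed.

Lemma has_dim_sector m : has_dim (@sector R m) m.+1.
Proof.
exists (fun k : 'I_m.+1 => ket R (m - k) k); split; last by reflexivity.
move=> c h k.
have := congr1 (fun f => f (m - k, val k)%N) h; rewrite sum_ketE /= subnK; last by rewrite -ltnS.
by rewrite eqxx inord_val.
Qed.

Lemma numop_nE psi n : numop psi n = (n.1 + n.2)%:R * psi n.
Proof.
apply/eqP; rewrite eq_complex; apply/andP; split; apply/eqP.
  rewrite [LHS](congr1 (fun f => f n) (reF_numop psi)) rnumE.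
  by rewrite -(rmorph_nat (real_complex R)) reF_real.
rewrite [LHS](congr1 (fun f => f n) (imF_numop psi)) rnumE.
by rewrite -(rmorph_nat (real_complex R)) imF_real.
Qed.

Lemma numop_sector m psi : sector m psi <-> numop psi = m%:R *: psi.
Proof.
split=> [/sectorP h|h].
  apply/funext => n; rewrite numop_nE fctE; have [->//|nm] := eqVneq (n.1 + n.2)%N m.
  by rewrite h // scaler0 mulr0.
apply/sectorP => n nm; have := congr1 (fun f => f n) h; rewrite numop_nE fctE => /eqP.
rewrite -subr_eq0 -[_ *: _]/(_ * _) -mulrBl mulf_eq0 subr_eq0 eqr_nat (negbTE nm).
by move=> /eqP.
Qed.

Lemma sectorE m : @sector R m = [set psi | [/\ ell2 psi, ell2 (numop psi) &
  numop psi = m%:R *: psi]].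
Proof.
apply/seteqP; split=> [psi h|psi [_ _ h]]; last exact/numop_sector.
have hs := sector_smooth h; split; [exact: (hs 0%N)|exact: (hs 1%N)|exact/numop_sector].
Qed.

Lemma JSplusE psi n : JSplus psi n =
  (Num.sqrt n.1%:R * Num.sqrt n.2.+1%:R)%:C * psi (n.1.-1, n.2.+1).
Proof. by rewrite rmorphM -mulrA. Qed.
Lemma JSminusE psi n : JSminus psi n =
  (Num.sqrt n.2%:R * Num.sqrt n.1.+1%:R)%:C * psi (n.1.+1, n.2.-1).
Proof. by rewrite rmorphM -mulrA. Qed.

Lemma sector_stable m : spin_stable JSplus JSminus Sz (@sector R m).
Proof.
have hn psi : sector m psi -> forall A : op R, (forall phi, numop (A phi) = A (numop phi)) ->
    (forall c phi, A (c *: phi) = c *: A phi) -> sector m (A psi).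
  by move=> /numop_sector h A hA hZ; apply/numop_sector; rewrite hA h hZ.
split=> psi /hn; apply.
- exact: numop_JSplus.
- by move=> c phi; rewrite /JSplus /= a2Z a1dZ.
- exact: numop_JSminus.
- by move=> c phi; rewrite /JSminus /= a1Z a2dZ.
- exact: numop_Sz.
- by move=> c phi; rewrite !SzE !(a1Z, a2Z, a1dZ, a2dZ) -scalerBr scalerA mulrC -scalerA.
Qed.

Lemma sqrtM_neq0 (i j : nat) : (Num.sqrt i.+1%:R * Num.sqrt j.+1%:R)%:C != 0 :> R[i].
Proof. by rewrite fmorph_eq0 mulf_neq0 // sqrtS_neq0. Qed.

Lemma subspaceZ W c psi : Defs.subspace W -> W psi -> W (c *: psi).
Proof. by move=> [h0 h] hp; rewrite -[_ *: _]addr0; apply: h. Qed.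

Lemma subspace_unscale W c psi : Defs.subspace W -> c != 0 -> W (c *: psi) -> W psi.
Proof.
by move=> hW c0 /(subspaceZ c^-1 hW); rewrite scalerA mulVf // scale1r.
Qed.

(* The raising operator brings the lowest-weight component that occurs up to the top. *)
Lemma top_ket m W : Defs.subspace W -> W `<=` sector m -> stable JSplus W ->
  forall n, (n <= m)%N -> forall w, W w -> (forall i, (n < i)%N -> w (m - i, i)%N = 0) ->
  w (m - n, n)%N != 0 -> W (ket R m 0).
Proof.
move=> hW Wm sW; elim=> [|n IH] nm w Ww hw wn.
  apply: (subspace_unscale hW wn); rewrite subn0.
  suff <- : w = w (m, 0)%N *: ket R m 0 by [].
  apply/funext => -[i j]; rewrite fctE ketE xpair_eqE /GRing.scale /=.
  have [ijm|ijm] := eqVneq (i + j)%N m; last first.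
    have /sectorP -> // := Wm _ Ww.
    case: eqP => [iE|_]; last by rewrite mulr0.
    by case: eqP => [jE|_]; [rewrite iE jE addn0 eqxx in ijm|rewrite mulr0].
  case: j ijm => [|j] ijm; first by rewrite -ijm addn0 !eqxx mulr1.
  by rewrite andbF mulr0; have := hw j.+1 isT; rewrite -ijm addnK.
apply: (IH (ltnW nm) (JSplus w)); first exact: sW.
- move=> i ni; rewrite JSplusE /= -subnS hw ?mulr0 //.
- rewrite JSplusE /= -subnS mulf_neq0 //.
  by move: nm; rewrite -subn_gt0; case: (m - n)%N => // k _; exact: sqrtM_neq0.
Qed.

Lemma lower_kets m W : Defs.subspace W -> stable JSminus W -> W (ket R m 0) ->
  forall n, (n <= m)%N -> W (ket R (m - n) n).
Proof.
move=> hW sW W0; elim=> [|n IH] nm; first by rewrite subn0.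
have := sW _ (IH (ltnW nm)); set k := (m - n.+1)%N.
have -> : (m - n)%N = k.+1 by rewrite /k subnS prednK // subn_gt0.
have -> : JSminus (ket R k.+1 n) = (Num.sqrt n.+1%:R * Num.sqrt k.+1%:R)%:C *: ket R k n.+1.
  apply/funext => -[i [|j]]; rewrite JSminusE fctE !ketE !xpair_eqE /GRing.scale /=.
    by rewrite sqrtr0 mul0r andbF mulr0 mul0r.
  rewrite !eqSS; case: (eqVneq i k) => [->|_] /=; last by rewrite !mulr0.
  by case: (eqVneq j n) => [->|_] //=; rewrite !mulr0.
apply: subspace_unscale => //; exact: sqrtM_neq0.
Qed.

(** Take a nonzero [w] in [W] and the largest index [p] of a nonzero component. Raising [p] times
    leaves a multiple of [ket R m 0], from which lowering reaches the whole basis. *)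
Lemma irreducible_sector m : irreducible_spin_block JSplus JSminus Sz m (@sector R m).
Proof.
split; [exact: has_dim_sector|exact: sector_stable|move=> W hW Wm [sp sm s0]].
have [h|/existsNP[w /not_implyP[Ww /eqP w0]]] := pselect (forall w, W w -> w = 0).
  left; apply/seteqP; split=> [w /h//|_ ->]; by case: hW.
right; apply/seteqP; split=> // psi [c ->].
suff hk n : (n <= m)%N -> W (ket R (m - n) n).
  elim/big_ind: _ => [|x y Wx Wy|k _]; first by case: hW.
    by rewrite -(scale1r x); case: hW => _; apply.
  by apply: subspaceZ => //; apply: hk; rewrite -ltnS.
apply: lower_kets => //.
pose P n := (n <= m)%N && (w (m - n, n)%N != 0).
have exP : exists n, P n.
  apply: contrapT => /forallNP hP; case/eqP: w0; apply/funext => -[i j].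
  have [ijm|ijm] := eqVneq (i + j)%N m; last by have /sectorP -> := Wm _ Ww.
  apply/eqP/negPn/negP => wij; apply: (hP j); rewrite /P -ijm leq_addl addnK.
  exact: wij.
have ubP : forall k, P k -> (k <= m)%N by move=> k /andP[].
have [p /andP[pm wp] pmax] := ex_maxnP exP ubP.
apply: (top_ket hW Wm sp pm Ww) => // i pi; apply/eqP/negPn/negP => wi.
(* For [i > m] truncated subtraction gives the index [(0, i)], which lies outside the sector. *)
have [im|mi] := leqP i m.
  by have := pmax i; rewrite /P im wi leqNgt pi => /(_ isT).
case/negP: wi; have /sectorP -> // := Wm _ Ww.
by rewrite /= (eqP (ltnW mi : (m - i == 0)%N)) add0n neq_ltn mi orbT.
Qed.

(** * Squeezed sectors *)

Section SqueezedSector.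
Variable U : R -> op R.
Hypothesis hU : unitary_group_generated_by squeezing_generator U.

Let lin r c psi phi : smooth psi -> smooth phi -> U r (c *: psi + phi) = c *: U r psi + U r phi.
Proof. by move=> h1 h2; apply: (group_lin hU); exact: smooth_cl2. Qed.

Lemma group_sum r J (s : seq J) (F : J -> fock R) : (forall j, smooth (F j)) ->
  U r (\sum_(j <- s) F j) = \sum_(j <- s) U r (F j).
Proof.
move=> hF; have hs (t : seq J) : smooth (\sum_(j <- t) F j).
  elim/big_ind: _ => [|*|*]; rewrite -?(scale0r (ket R 0 0)) //; last exact: smoothD.
  exact/smoothZ/smooth_ket.
elim: s => [|j s IH]; first by rewrite !big_nil (group0 hU).
by rewrite !big_cons (group_add hU) ?IH //; exact: smooth_cl2.
Qed.

(** [U r] intertwines the generators, so an invariant subspace pulls back to the unsqueezed sector.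
    The preimage [W'] is taken inside the sector because [U r] is known to be linear only on
    [ell2]. *)
Lemma irreducible_squeezed_sector r m :
  irreducible_spin_block (Splus r) (Sminus r) Sz m (squeezed_sector U r m).
Proof.
have [_ [sp sm s0] irr] := irreducible_sector m.
have ss psi := @sector_smooth m psi.
split.
- have [e [free VE]] := has_dim_sector m.
  have se j : smooth (e j).
    apply: (@sector_smooth m); rewrite VE; exists (fun k => (k == j)%:R).
    rewrite (bigD1 j) //= eqxx scale1r big1 ?addr0 // => k /negbTE ->.
    by rewrite scale0r.
  have sZ (c : 'I_m.+1 -> R[i]) j : smooth (c j *: e j) by exact: smoothZ.
  have Usum c : U r (\sum_j c j *: e j) = \sum_j c j *: U r (e j).
    rewrite group_sum //; apply: eq_bigr => j _.
    by rewrite (groupZ hU) //; exact: smooth_cl2.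
  exists (fun j => U r (e j)); split.
    move=> c; rewrite -Usum => h; apply: free.
    have hc : smooth (\sum_j c j *: e j) by apply: (@sector_smooth m); rewrite VE; exists c.
    by rewrite -(groupNK hU r (smooth_cl2 hc)) h (group0 hU).
  apply/seteqP; split=> [_ [psi + <-]|psi [c ->]].
    by rewrite VE => -[c ->]; exists c; rewrite Usum.
  by exists (\sum_j c j *: e j); rewrite ?VE ?Usum //; exists c.
- split=> _ [psi hp <-].
  + by exists (JSplus psi); [exact: sp|exact: (group_JSplus hU _ (ss _ hp))].
  + by exists (JSminus psi); [exact: sm|exact: (group_JSminus hU _ (ss _ hp))].
  + by exists (Sz psi); [exact: s0|exact: (group_Sz hU _ (ss _ hp))].
move=> W [W0 WL] Wsub [wp wm w0].
pose W' : set (fock R) := [set psi | sector m psi /\ W (U r psi)].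
have [] := irr W'.
- split; first by split; [case: (subspace_sector m)|rewrite (group0 hU)].
  move=> c psi phi [s1 h1] [s2 h2]; split; first by case: (subspace_sector m) => _; apply.
  by rewrite lin ?(ss _ s1) ?(ss _ s2) //; [apply: WL|exact: ss|exact: ss].
- by move=> psi [].
- split=> psi [hp hW]; split.
  + exact: sp.
  + by rewrite (group_JSplus hU _ (ss _ hp)); apply: wp.
  + exact: sm.
  + by rewrite (group_JSminus hU _ (ss _ hp)); apply: wm.
  + exact: s0.
  + by rewrite (group_Sz hU _ (ss _ hp)); apply: w0.
- move=> W'0; left; apply/seteqP; split=> [w Ww|_ -> //].
  have [psi hp e] := Wsub _ Ww; have : W' psi by split; rewrite ?e.
  by rewrite W'0 => p0; rewrite -e p0 (group0 hU).
- move=> W'E; right; apply/seteqP; split=> // _ [psi hp <-].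
  by have [] : W' psi by rewrite W'E.
Qed.

(** The second condition is the domain of the conjugated number operator: the values of [U r]
    outside [ell2] are arbitrary, and it is what allows [U r] to be undone in the eigenvalue
    equation. *)
Lemma squeezed_sectorE r m : squeezed_sector U r m =
  [set psi | [/\ ell2 psi, ell2 (numop (U (- r) psi)) &
     conj_by U r numop psi = m%:R *: psi]].
Proof.
apply/seteqP; split=> [_ [phi hphi <-]|psi [/ell2P hp /ell2P hn e]].
  have hs := sector_smooth hphi; have hc := smooth_cl2 hs.
  have [h1 h2] := (hs 0%N, hs 1%N); split.
  - by apply/ell2P; exact: (group_cl2 hU).
  - by rewrite (groupNK hU).
  - rewrite /conj_by /= (groupNK hU) // (proj1 (numop_sector m phi) hphi).
    by rewrite (groupZ hU).
exists (U (- r) psi); last exact: (groupK hU).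
apply/numop_sector; rewrite -(groupZ hU) // -e /conj_by /=.
by rewrite (groupNK hU).
Qed.

End SqueezedSector.

Lemma sinh_double_neq0 (r : R) : r != 0 -> sinh (2 * r) != 0.
Proof.
apply: contraNneq => /sinh_eq0 /eqP; by rewrite mulf_eq0 pnatr_eq0.
Qed.

(** The vacuum detects it: only the term with two creations in mode 1 survives, with coefficient -
    sinh(2r) sqrt 2 at (2, 0). *)
Lemma commutator_numop_Splus_neq0 (r : R) : r != 0 ->
  ~ eq_on_smooth (commutator numop (Splus r)) 0.
Proof.
move=> r0 /(_ _ (smooth_ket R 0 0)) /(congr1 (fun f => f (2, 0)%N)).
rewrite commutator_numop_Splus !fctE /a2 /a1d /= !ketE /= mulr0 mulr0 sub0r !mulr1.
move=> /eqP; rewrite [_ == _](_ : _ = ((sinh (2 * r))%:C *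
  - ((Num.sqrt 2%:R)%:C * (Num.sqrt 1%:R)%:C) == 0 :> R[i])) //.
rewrite mulf_eq0 oppr_eq0 mulf_eq0 !fmorph_eq0.
by rewrite (negbTE (sinh_double_neq0 r0)) !(negbTE (sqrtS_neq0 _ _)).
Qed.

Lemma commutator_numop_Sminus_neq0 (r : R) : r != 0 ->
  ~ eq_on_smooth (commutator numop (Sminus r)) 0.
Proof.
move=> r0 /(_ _ (smooth_ket R 0 0)) /(congr1 (fun f => f (0, 2)%N)).
rewrite commutator_numop_Sminus !fctE /a1 /a2d /= !ketE /= mulr0 mulr0 sub0r !mulr1.
move=> /eqP; rewrite [_ == _](_ : _ = ((sinh (2 * r))%:C *
  - ((Num.sqrt 2%:R)%:C * (Num.sqrt 1%:R)%:C) == 0 :> R[i])) //.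
rewrite mulf_eq0 oppr_eq0 mulf_eq0 !fmorph_eq0.
by rewrite (negbTE (sinh_double_neq0 r0)) !(negbTE (sqrtS_neq0 _ _)).
Qed.

Lemma Splus0 : Splus (0 : R) = @a1d R \o @a2 R.
Proof.
apply/funext => psi; rewrite SplusE mulr0 cosh0 sinh0 mul0r rmorph1 rmorph0.
by rewrite scale1r scale0r subr0.
Qed.

Lemma Sminus0 : Sminus (0 : R) = @a2d R \o @a1 R.
Proof.
apply/funext => psi; rewrite SminusE mulr0 cosh0 sinh0 mul0r rmorph1 rmorph0.
by rewrite scale1r scale0r subr0.
Qed.

End Sectors.

Theorem mainTheorem6 (R : realType) :
  (* su(2) relations *)
  (forall r : R,
     [/\ commutator Sz (Splus r) = Splus r,
         commutator Sz (Sminus r) = - Sminus r &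
         commutator (Splus r) (Sminus r) = 2 *: Sz]) /\
  (* reduction to Jordan--Schwinger at r = 0 *)
  (Splus (0 : R) = @a1d R \o @a2 R /\ Sminus (0 : R) = @a2d R \o @a1 R) /\
  (* the quadratic terms present for r <> 0 change the boson number by 2 *)
  ([/\ changes_number_by 2 (@a1d R \o @a1d R),
       changes_number_by (- 2) (@a2 R \o @a2 R),
       changes_number_by (- 2) (@a1 R \o @a1 R) &
       changes_number_by 2 (@a2d R \o @a2d R)] /\
   forall r : R, r != 0 ->
     [/\ sinh (2 * r) != 0,
         ~ eq_on_smooth (commutator numop (Splus r)) 0 &
         ~ eq_on_smooth (commutator numop (Sminus r)) 0]) /\
  (* the squeezing group exists, and any such group has the stated properties *)
  (exists U : R -> op R, unitary_group_generated_by squeezing_generator U) /\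
  (forall U : R -> op R, unitary_group_generated_by squeezing_generator U ->
   forall r : R,
     stable (U r) smooth /\
     (eq_on_smooth (Splus r) (conj_by U r JSplus) /\
      eq_on_smooth (Sminus r) (conj_by U r JSminus)) /\
     [/\ eq_on_smooth (commutator (conj_by U r numop) (Splus r)) 0,
         eq_on_smooth (commutator (conj_by U r numop) (Sminus r)) 0 &
         eq_on_smooth (commutator (conj_by U r numop) Sz) 0] /\
     eq_on_smooth (conj_by U r numop)
       ((cosh (2 * r))%:C *: (num1 + num2)
        - (sinh (2 * r))%:C *: ((@a1d R \o @a2d R) + (@a1 R \o @a2 R))
        + (2 * sinh r ^+ 2)%:C *: id) /\
     forall m : nat, (0 < m)%N ->
       [/\ irreducible_spin_block JSplus JSminus Sz m (@sector R m),
           irreducible_spin_block (Splus r) (Sminus r) Sz m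
             (squeezed_sector U r m),
           @sector R m = [set psi | [/\ ell2 psi, ell2 (numop psi) &
             numop psi = m%:R *: psi]] &
           squeezed_sector U r m =
             [set psi | [/\ ell2 psi, ell2 (numop (U (- r) psi)) &
                conj_by U r numop psi = m%:R *: psi]]]).
Proof.
split; first by move=> r; split; [exact: commutator_Sz_Splus
  |exact: commutator_Sz_Sminus|exact: commutator_Splus_Sminus].
split; first by split; [exact: Splus0|exact: Sminus0].
split.
  split; first by split; [exact: changes_number_a1d_a1d|exact: changes_number_a2_a2
    |exact: changes_number_a1_a1|exact: changes_number_a2d_a2d].
  by move=> r r0; split; [exact: sinh_double_neq0|exact: commutator_numop_Splus_neq0
    |exact: commutator_numop_Sminus_neq0].
split; first by exists (@squeezing R); exact: squeezing_generated.
move=> U hU r.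
split; first by move=> psi; exact: (group_smooth hU).
split.
  split=> psi h; apply/esym; apply: (conj_byE hU) => // phi.
    exact: (group_JSplus hU).
  exact: (group_JSminus hU).
split.
  split.
  - apply: (commutator_conj_numop hU (@smooth_JSplus R)) => phi; last exact: numop_JSplus.
    exact: (group_JSplus hU).
  - apply: (commutator_conj_numop hU (@smooth_JSminus R)) => phi; last exact: numop_JSminus.
    exact: (group_JSminus hU).
  - apply: (commutator_conj_numop hU (@smooth_Sz R)) => phi; last exact: numop_Sz.
    exact: (group_Sz hU).
split.
  by move=> psi h; apply: (conj_byE hU) => // phi hphi; rewrite (group_numop hU).
move=> m _; split.
- exact: irreducible_sector.
- exact: irreducible_squeezed_sector.
- exact: sectorE.
- exact: squeezed_sectorE.
Qed.
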